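(* Let $Z$ be the stationary workload in the system, and let $\beta=(1-\lambda)\alpha$ and $T=S+\lambda\mathbf 1\alpha$. Then for all $t\ge 0$ $$P[Z>t]=\lambda\,\alpha e^{Tt}(-S)^{-1}\mathbf 1=\lambda\,\beta e^{Tt}(-T)^{-1}\mathbf 1 .$$ Moreover, let $\theta_i=-\lim_{t\to\infty}\frac1t\log P[X_i>t]$ for $i=1,2$ and $\theta_Z=-\lim_{t\to\infty}\frac1t\log P[Z>t]$. Then $0<\theta_Z<\min(\theta_1,\theta_2)$.
   Context: Single-server queue with a work-conserving scheduling algorithm and Poisson arrivals of rate $\lambda\in(0,1)$. Each arriving job is, independently, of type 1 with probability $p$ and of type 2 with probability $1-p$, where $0<p<1$. The processing time $X_i$ of a type-$i$ job has an order-$n_i$ phase-type distribution $(\alpha_i,S_i)$, i.e. $P[X_i>t]=\alpha_i e^{S_it}\mathbf 1$, where $\alpha_i$ is a probability row vector of size $n_i$, $S_i$ is an invertible subgenerator matrix of size $n_i$ (negative diagonal, nonnegative off-diagonal entries, nonpositive row sums), and $\mathbf 1$ is a column vector of ones of appropriate size. All processing times and interarrival times are independent. The job size $X$ of an arbitrary job is the mixture equal to $X_1$ with probability $p$ and $X_2$ with probability $1-p$; it is phase-type with representation $(\alpha,S)$, where $\alpha=(p\alpha_1,(1-p)\alpha_2)$ and $S=\begin{bmatrix}S_1&0\\0&S_2\end{bmatrix}$. It is normalized so that $E[X]=pE[X_1]+(1-p)E[X_2]=\alpha(-S)^{-1}\mathbf 1=1$, so the load equals $\lambda$. The workload is the total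 amount of unfinished work in the system (it does not depend on which work-conserving algorithm is used). *)

(* Defs.v *)
From HB Require Import structures.
From mathcomp Require Import all_boot all_order all_algebra.
From mathcomp Require Import all_classical all_reals all_analysis.

Set Implicit Arguments.
Unset Strict Implicit.
Unset Printing Implicit Defensive.

Import Order.TTheory GRing.Theory Num.Theory.
Import numFieldTopology.Exports numFieldNormedType.Exports.

Local Open Scope classical_set_scope.
Local Open Scope ring_scope.

(* Entrywise limit of the exponential power series; each of these scalar
   series converges absolutely. *)
Definition expmx (R : realType) (n : nat) (A : 'M[R]_n) : 'M[R]_n :=
  \matrix_(i, j) limn (series (fun k : nat => (A ^+ k) i j / k`!%:R)).

Definition probability_vector (R : realType) (n : nat) (a : 'rV[R]_n) : Prop :=
  (forall i, 0 <= a 0 i) /\ \sum_i a 0 i = 1.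

Definition subgenerator (R : realType) (n : nat) (S : 'M[R]_n) : Prop :=
  [/\ forall i, S i i < 0,
      forall i j, i != j -> 0 <= S i j &
      forall i, \sum_j S i j <= 0].

Definition total_mass (R : realType) (n : nat) (a : 'rV[R]_n) : R :=
  (a *m (const_mx 1 : 'cV[R]_n)) 0 0.

Definition phase_type d (Omega : measurableType d) (R : realType)
    (P : probability Omega R) (X : {RV P >-> R})
    (n : nat) (a : 'rV[R]_n) (S : 'M[R]_n) : Prop :=
  forall t : R, 0 <= t -> ccdf X t = (total_mass (a *m expmx (t *: S)))%:E.

Definition mixture_vector (R : realType) (n1 n2 : nat) (p : R)
    (a1 : 'rV[R]_n1) (a2 : 'rV[R]_n2) : 'rV[R]_(n1 + n2) :=
  row_mx (p *: a1) ((1 - p) *: a2).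

Definition mixture_matrix (R : realType) (n1 n2 : nat)
    (S1 : 'M[R]_n1) (S2 : 'M[R]_n2) : 'M[R]_(n1 + n2) :=
  block_mx S1 0 0 S2.

(* Sample-path workload of a work-conserving single server: it starts at w0,
   decreases at unit rate while positive, and jumps by x k at the arrival of
   job k.  Job k arrives at time tau 0 + ... + tau k. *)
Definition arrival_epoch (R : realType) (tau : nat -> R) (n : nat) : R :=
  \sum_(0 <= k < n) tau k.

(* Workload just after the n-th arrival (at time 0 if n = 0). *)
Fixpoint workload_after (R : realType) (w0 : R) (tau x : nat -> R)
    (n : nat) : R :=
  if n is m.+1 then Num.max 0 (workload_after w0 tau x m - tau m) + x m else w0.

(* For tau >= 0 at most one n satisfies the condition.  The default value
   only matters if infinitely many arrivals occur by time t, which for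
   Poisson arrivals has probability zero. *)
Definition arrival_count (R : realType) (tau : nat -> R) (t : R) : nat :=
  xget 0%N [set n | arrival_epoch tau n <= t < arrival_epoch tau n.+1].

Definition workload (R : realType) (w0 : R) (tau x : nat -> R) (t : R) : R :=
  let n := arrival_count tau t in
  Num.max 0 (workload_after w0 tau x n - (t - arrival_epoch tau n)).

Definition job_size (Omega : Type) (R : realType) (is_type1 : nat -> Omega -> bool)
    (X1 X2 : nat -> Omega -> R) (k : nat) (w : Omega) : R :=
  if is_type1 k w then X1 k w else X2 k w.

(* w0 is stationary if, started from it, the workload has the law of w0 at
   all times. *)
Definition stationary_workload d (Omega : measurableType d) (R : realType)
    (P : probability Omega R) (w0 : {RV P >-> R}) (tau x : nat -> Omega -> R) :
    Prop :=
  forall t : R, 0 <= t -> forall A : set R, measurable A ->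
    P [set w | A (workload (w0 w) (tau ^~ w) (x ^~ w) t)] =
    distribution P w0 A.

Definition mutually_independent d (Omega : measurableType d) (R : realType)
    (P : probability Omega R) (I : Type) (E : I -> set (set Omega)) : Prop :=
  forall (n : nat) (s : 'I_n -> I), injective s ->
  forall A : 'I_n -> set Omega, (forall k, E (s k) (A k)) ->
    P (\bigcap_k A k) = (\prod_(k < n) P (A k))%E.

Inductive input : Type :=
| Initial_workload
| Interarrival_time of nat
| Job_type of nat
| Type1_time of nat
| Type2_time of nat.

Definition input_events d (Omega : measurableType d) (R : realType)
    (Z : Omega -> R) (tau : nat -> Omega -> R) (is_type1 : nat -> Omega -> bool)
    (X1 X2 : nat -> Omega -> R) (i : input) : set (set Omega) :=
  match i with
  | Initial_workload => preimage_set_system setT Z measurable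
  | Interarrival_time k => preimage_set_system setT (tau k) measurable
  | Job_type k => preimage_set_system setT (is_type1 k) measurable
  | Type1_time k => preimage_set_system setT (X1 k) measurable
  | Type2_time k => preimage_set_system setT (X2 k) measurable
  end.

(* theta = - lim (1/t) log P[X > t]; lne is the extended logarithm, so a
   vanishing tail gives -oo. *)
Definition has_decay_rate d (Omega : measurableType d) (R : realType)
    (P : probability Omega R) (X : {RV P >-> R}) (theta : R) : Prop :=
  ((t^-1)%:E * lne (ccdf X t))%E @[t --> +oo%R] --> (- theta)%:E.

(* Main.v *)
Require Import Defs.
From HB Require Import structures.
From mathcomp Require Import all_boot all_order all_algebra.
From mathcomp Require Import all_classical all_reals all_analysis.
From mathcomp Require Import ring lra measurable_realfun.

Set Implicit Arguments.
Unset Strict Implicit.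
Unset Printing Implicit Defensive.

Import Order.TTheory GRing.Theory Num.Theory.
Import numFieldTopology.Exports numFieldNormedType.Exports.

Local Open Scope classical_set_scope.
Local Open Scope ring_scope.

(** Stationarity over a short time [h] gives, up to [O(h^2)],
    [P(Z > x) - P(Z > x + h) = lambda h P(Z <= x < Z + X)].  The row vector
    [m x = E(1_{Z <= x} alpha e^{(x - Z) S})] of expected phases of the job
    crossing level [x] has total mass [P(Z <= x < Z + X)] and satisfies
    [m (x + h) = m x e^{h T} + O(h^2)].  Hence [m x = P(Z = 0) alpha e^{x T}];
    integrating the first relation and letting [x] go to infinity determines
    [P(Z > x)], and then [P(Z = 0)], because [E X = 1].

    For the decay rates, a nonnegative matrix [M] and a nonnegative row [b] whose
    support is closed under [M] have a growth rate, the infimum of those [mu] for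
    which [eta M + b <= mu eta] has a solution [eta >= 0].  The infimum is not
    attained, and a compactness argument yields an eigenvector supported on the
    support of [b]; it bounds [b e^{t M} v] from below, and supersolutions bound
    it from above.  For [T] this eigenvector, suitably normalized, satisfies
    [eta S + alpha = - theta_Z eta], so it is a supersolution for [S_1] and [S_2]
    strictly above their own growth rates.  Pairing the eigenvector equation with
    [(-S)^-1 1] gives [theta_Z > 0]. *)

(** * Matrix exponentials *)

(** Nothing is known at the outset about the regularity of the law of [Z], and stationarity is only
    an equality of laws at fixed times, so no differential equation is available for the tail. Each
    evolution law is therefore an increment over a step [h] with an error quadratic in [h], and
    subdividing an interval makes the accumulated error vanish. To that order only the first two
    interarrival times and the first job matter, because two arrivals within [h] have probability
    O(h^2).

    The two halves of the theorem are intertwined: the increments determine the tail up to a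
    constant, which is removed by letting the level grow. This requires e^{xT} to decay along alpha,
    so positivity of the decay exponent of [T] is proved before the tail formula.

    [S1] and [S2] may be reducible and the initial vectors may vanish at some phases, so a decay
    rate depends on the initial vector as well as on the matrix. This is why growth rates are
    attached to a pair of a matrix and a row, the support of the row taking the place of
    irreducibility. *)

Section MatrixExponential.
Variable R : realType.

Definition mxsum (m n : nat) (A : 'M[R]_(m, n)) : R := \sum_i \sum_j `|A i j|.

Lemma mxsum_ge0 m n (A : 'M[R]_(m, n)) : 0 <= mxsum A.
Proof. by apply: sumr_ge0 => i _; apply: sumr_ge0. Qed.

Lemma row_norm_le_mxsum m n (A : 'M[R]_(m, n)) i : \sum_j `|A i j| <= mxsum A.
Proof.
rewrite /mxsum (bigD1 i) //= lerDl.
by apply: sumr_ge0 => k _; apply: sumr_ge0.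
Qed.

Lemma norm_le_mxsum m n (A : 'M[R]_(m, n)) i j : `|A i j| <= mxsum A.
Proof.
apply: le_trans (row_norm_le_mxsum A i).
by rewrite (bigD1 j) //= lerDl sumr_ge0.
Qed.

Lemma exprmxZ n (A : 'M[R]_n) (t : R) k : (t *: A) ^+ k = t ^+ k *: A ^+ k.
Proof.
elim: k => [|k IH]; first by rewrite !expr0 scale1r.
rewrite !exprS IH -!mulmxE -scalemxAl -scalemxAr scalerA //.
Qed.

Lemma exprmx_bound n (A : 'M[R]_n) k i j : `|(A ^+ k) i j| <= mxsum A ^+ k.
Proof.
elim: k i j => [|k IH] i j.
  by rewrite !expr0 mxE; case: (i == j); rewrite ?normr1 ?normr0.
rewrite !exprS mxE (le_trans (ler_norm_sum _ _ _)) //.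
apply: le_trans (_ : \sum_l `|A i l| * mxsum A ^+ k <= _).
  by apply: ler_sum => l _; rewrite normrM ler_wpM2l.
rewrite -mulr_suml ler_wpM2r ?exprn_ge0 ?mxsum_ge0 //.
exact: row_norm_le_mxsum.
Qed.

(** Partial sums are kept as matrices so that fixed factors can be multiplied in before the
    entrywise limit that defines [expmx] is taken. *)
Definition expmx_part n (A : 'M[R]_n) (N : nat) : 'M[R]_n :=
  \sum_(0 <= k < N) (k`!%:R)^-1 *: A ^+ k.

Lemma expmx_partE n (A : 'M[R]_n) N i j :
  expmx_part A N i j = series (fun k => (A ^+ k) i j / k`!%:R) N.
Proof.
rewrite /expmx_part summxE /series /=.
by apply: eq_bigr => k _; rewrite mxE mulrC.
Qed.

(** Each entry is dominated, term by term, by the scalar exponential series of [mxsum A]. *)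
Lemma expmx_part_cvg n (A : 'M[R]_n) i j :
  expmx_part A N i j @[N --> \oo] --> expmx A i j.
Proof.
rewrite (_ : (fun N => _) = series (fun k => (A ^+ k) i j / k`!%:R)); last first.
  by apply/funext => N; rewrite expmx_partE.
rewrite mxE.
suff : cvgn [normed series (fun k => (A ^+ k) i j / k`!%:R)].
  by move/normed_cvg.
apply: (series_le_cvg _ _ _ (is_cvg_series_exp_coeff (mxsum A))) => k /=.
- by [].
- by rewrite /exp_coeff /= divr_ge0 // exprn_ge0 // mxsum_ge0.
rewrite /exp_coeff /= normrM normfV normr_nat ler_wpM2r //.
exact: exprmx_bound.
Qed.

Arguments expmx_part_cvg {n} A i j.

Lemma cvg_sumr (T : Type) (F : set_system T) {FF : Filter F} n
    (f : 'I_n -> T -> R) (a : 'I_n -> R) :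
  (forall i, f i x @[x --> F] --> a i) ->
  \sum_i f i x @[x --> F] --> \sum_i a i.
Proof.
move=> fa; elim: n f a fa => [|n IH] f a fa.
  rewrite big_ord0 (_ : (fun x => _) = cst 0); first exact: cvg_cst.
  by apply/funext => x; rewrite big_ord0.
rewrite big_ord_recl (_ : (fun x => _) =
  (fun x => f ord0 x + \sum_(i < n) f (lift ord0 i) x)); last first.
  by apply/funext => x; rewrite big_ord_recl.
apply: cvgD (fa _) _.
by apply: (IH (fun i => f (lift ord0 i)) (fun i => a (lift ord0 i))) => i; exact: fa.
Qed.

Lemma cvg_mulmxl (T : Type) (Fi : set_system T) {FF : Filter Fi} m n p
    (B : 'M[R]_(m, n)) (F : T -> 'M[R]_(n, p)) (G : 'M[R]_(n, p)) :
  (forall i j, F N i j @[N --> Fi] --> G i j) ->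
  forall i j, (B *m F N) i j @[N --> Fi] --> (B *m G) i j.
Proof.
move=> FG i j; rewrite mxE.
rewrite (_ : (fun N => _) = (fun N => \sum_l B i l * F N l j)); last first.
  by apply/funext => N; rewrite mxE.
by apply: cvg_sumr => l; apply: cvgM; [exact: cvg_cst|exact: FG].
Qed.

Lemma cvg_mulmxr (T : Type) (Fi : set_system T) {FF : Filter Fi} m n p
    (B : 'M[R]_(n, p)) (F : T -> 'M[R]_(m, n)) (G : 'M[R]_(m, n)) :
  (forall i j, F N i j @[N --> Fi] --> G i j) ->
  forall i j, (F N *m B) i j @[N --> Fi] --> (G *m B) i j.
Proof.
move=> FG i j; rewrite mxE.
rewrite (_ : (fun N => _) = (fun N => \sum_l F N i l * B l j)); last first.
  by apply/funext => N; rewrite mxE.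
by apply: cvg_sumr => l; apply: cvgM; [exact: FG|exact: cvg_cst].
Qed.

Lemma expmx_comm n (A B : 'M[R]_n) :
  A *m B = B *m A -> A *m expmx B = expmx B *m A.
Proof.
move=> AB; apply/matrixP => i j.
have h1 : (A *m expmx_part B N) i j @[N --> \oo] --> (A *m expmx B) i j.
  by apply: cvg_mulmxl => r s; exact: expmx_part_cvg.
have h2 : (expmx_part B N *m A) i j @[N --> \oo] --> (expmx B *m A) i j.
  by apply: cvg_mulmxr => r s; exact: expmx_part_cvg.
rewrite -(cvg_lim _ h1) // -(cvg_lim _ h2) //.
congr (limn _).
apply/funext => N; congr (fun_of_matrix _ i j).
rewrite /expmx_part mulmx_sumr mulmx_suml; apply: eq_bigr => k _.
rewrite -scalemxAl -scalemxAr; congr (_ *: _).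
elim: k => [|k IH]; first by rewrite !expr0 mulmxE mulr1 mul1r.
by rewrite !exprS -!mulmxE mulmxA AB -!mulmxA IH.
Qed.

Lemma expmx_left_eigen m n (a : 'M[R]_(m, n)) (A : 'M[R]_n) mu :
  a *m A = mu *: a -> a *m expmx A = expR mu *: a.
Proof.
move=> aA; apply/matrixP => i j.
have h1 : (a *m expmx_part A N) i j @[N --> \oo] --> (a *m expmx A) i j.
  by apply: cvg_mulmxl => r s; exact: expmx_part_cvg.
rewrite -(cvg_lim _ h1) //; apply: cvg_lim => //.
rewrite (_ : (fun N => _) = (fun N => series (exp_coeff mu) N * a i j)).
  by rewrite mxE; apply: cvgM; [exact: is_cvg_series_exp_coeff|exact: cvg_cst].
apply/funext => N; rewrite /expmx_part mulmx_sumr summxE /series /= mulr_suml.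
apply: eq_bigr => k _; rewrite -scalemxAr.
have -> : a *m A ^+ k = mu ^+ k *: a.
  elim: k => [|k IH]; first by rewrite !expr0 mulmx1 scale1r.
  by rewrite exprSr -mulmxE mulmxA IH -scalemxAl aA scalerA -exprSr.
by rewrite !mxE /exp_coeff /=; ring.
Qed.

Lemma expmx_part_nondecr n (M : 'M[R]_n) i j : (forall k l, 0 <= M k l) ->
  nondecreasing_seq (fun N => expmx_part M N i j).
Proof.
move=> M0; have Mk k r s : 0 <= (M ^+ k) r s.
  elim: k r s => [|k IH] r s; first by rewrite expr0 mxE; case: (r == s).
  by rewrite exprS mxE sumr_ge0 // => l _; rewrite mulr_ge0.
apply/nondecreasing_seqP => N.
rewrite /expmx_part big_nat_recr //= [leRHS]mxE lerDl mxE.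
by rewrite mulr_ge0 ?invr_ge0.
Qed.

Lemma expmx_part_le n (M : 'M[R]_n) i j N : (forall k l, 0 <= M k l) ->
  expmx_part M N i j <= expmx M i j.
Proof.
move=> M0; have cv := expmx_part_cvg M i j.
rewrite -(cvg_lim _ cv) //.
apply: (@nondecreasing_cvgn_le _ (fun N => expmx_part M N i j)).
  exact: expmx_part_nondecr.
by apply/cvg_ex; exists (expmx M i j).
Qed.

Lemma exprmx_ge0 n (M : 'M[R]_n) k i j : (forall k l, 0 <= M k l) ->
  0 <= (M ^+ k) i j.
Proof.
move=> M0; elim: k i j => [|k IH] i j.
  by rewrite expr0 mxE; case: (i == j).
by rewrite exprS mxE sumr_ge0 // => l _; rewrite mulr_ge0.
Qed.

(** All terms are nonnegative. The case [k = 0] says that the exponential dominates the identity;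
    general [k] detects the states reachable in [k] steps. *)
Lemma expmx_ge_term n (M : 'M[R]_n) i j k : (forall k l, 0 <= M k l) ->
  (M ^+ k) i j / k`!%:R <= expmx M i j.
Proof.
move=> M0; apply: le_trans (expmx_part_le i j k.+1 M0).
rewrite /expmx_part big_nat_recr //= [leRHS]mxE [X in _ + X]mxE mulrC lerDr.
rewrite summxE sumr_ge0 // => l _.
by rewrite mxE mulr_ge0 ?invr_ge0 // exprmx_ge0.
Qed.

Lemma expmx_ge0 n (M : 'M[R]_n) i j : (forall k l, 0 <= M k l) ->
  0 <= expmx M i j.
Proof.
move=> M0; apply: le_trans (expmx_ge_term i j 0 M0).
by rewrite divr_ge0 // exprmx_ge0.
Qed.

Lemma expmx_norm n (A : 'M[R]_n) i j : `|expmx A i j| <= expR (mxsum A).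
Proof.
have cv : `|expmx_part A N i j| @[N --> \oo] --> `|expmx A i j|.
  by apply: cvg_norm; exact: expmx_part_cvg.
have cve := @is_cvg_series_exp_coeff R (mxsum A).
rewrite -(cvg_lim _ cv) // /expR; apply: ler_lim => //.
  by apply/cvg_ex; eexists; exact: cv.
near=> N; rewrite expmx_partE /series /=.
apply: le_trans (ler_norm_sum _ _ _) _; apply: ler_sum => k _.
rewrite /exp_coeff /= normrM normfV normr_nat ler_wpM2r //.
exact: exprmx_bound.
Unshelve. all: by end_near. Qed.

(** After the first two terms are removed, [h <= 1] allows [h ^+ k] to be replaced by [h ^+ 2] in
    every remaining term; what is left is part of the exponential series of [mxsum A]. *)
Lemma expmx_first_order n (A : 'M[R]_n) h i j : 0 <= h <= 1 ->
  `|expmx (h *: A) i j - (1%:M + h *: A) i j| <= h ^+ 2 * expR (mxsum A).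
Proof.
move=> /andP[h0 h1].
have cv : `|expmx_part (h *: A) N i j - (1%:M + h *: A) i j| @[N --> \oo] -->
    `|expmx (h *: A) i j - (1%:M + h *: A) i j|.
  by apply: cvg_norm; apply: cvgB (cvg_cst _); exact: (expmx_part_cvg (h *: A) i j).
rewrite -(cvg_lim _ cv) //; apply: limr_le; first by apply/cvg_ex; eexists; exact: cv.
near=> N.
have [M NE] : exists M, N = M.+2.
  by exists N.-2; near: N; exists 2%N => // -[|[|]].
rewrite NE expmx_partE /series /= 2?big_nat_recl //=.
rewrite expr0 expr1 fact0 factS fact0 !divr1 addrA.
set s := \sum_(0 <= k < M) _.
have -> : (1 : 'M[R]_n) i j + (h *: A) i j + s - (1%:M + h *: A) i j = s.
  by rewrite [(_ + h *: A) i j]mxE addrAC subrr add0r.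
rewrite /s.
apply: le_trans (ler_norm_sum _ _ _) _.
apply: le_trans (_ : h ^+ 2 * \sum_(0 <= k < M) exp_coeff (mxsum A) k.+2 <= _).
  rewrite mulr_sumr; apply: ler_sum => k _.
  have : (1 < k.+2)%N by [].
  move: (k.+2) => m m1; rewrite exprmxZ mxE !normrM normfV normr_nat.
  rewrite (_ : exp_coeff (mxsum A) m = mxsum A ^+ m / m`!%:R) // !mulrA.
  rewrite ler_wpM2r // ger0_norm ?exprn_ge0 //.
  apply: ler_pM; [by rewrite exprn_ge0|by []| |exact: exprmx_bound].
  by rewrite -(subnK m1) exprD ler_piMl ?exprn_ge0 // exprn_ile1.
rewrite ler_wpM2l ?exprn_ge0 //.
have ec k : 0 <= exp_coeff (mxsum A) k.
  by rewrite /exp_coeff /= divr_ge0 // exprn_ge0 // mxsum_ge0.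
apply: le_trans (_ : series (exp_coeff (mxsum A)) M.+2 <= _).
  rewrite /series /= 2?big_nat_recl //= addrA lerDr.
  by rewrite addr_ge0.
apply: nondecreasing_cvgn_le (is_cvg_series_exp_coeff _) _.
by apply/nondecreasing_seqP => k; rewrite /series /= big_nat_recr //= lerDl.
Unshelve. all: by end_near. Qed.

Lemma pseries_expmx_cvg n p (A : 'M[R]_n) (C : 'M[R]_(n, p)) i j t :
  pseries (fun k => (A ^+ k *m C) i j / k`!%:R) t @ \oo -->
  (expmx (t *: A) *m C) i j.
Proof.
have : (expmx_part (t *: A) N *m C) i j @[N --> \oo] --> (expmx (t *: A) *m C) i j.
  by apply: cvg_mulmxr => r s; exact: expmx_part_cvg.
rewrite (_ : (fun N => (expmx_part (t *: A) N *m C) i j) =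
  pseries (fun k => (A ^+ k *m C) i j / k`!%:R) t) //.
apply/funext => N; rewrite /expmx_part mulmx_suml summxE /pseries /series /=.
apply: eq_bigr => k _; rewrite exprmxZ scalerA -scalemxAl mxE.
by ring.
Qed.

(** Term-by-term differentiation shifts the coefficients by one, which turns the right factor [C]
    into [A *m C]; carrying [C] along keeps the derivative in the same form. *)
Lemma is_derive_expmx n p (A : 'M[R]_n) (C : 'M[R]_(n, p)) i j (t : R) :
  is_derive t 1 (fun s : R => (expmx (s *: A) *m C) i j)
    ((expmx (t *: A) *m (A *m C)) i j).
Proof.
have dE q (D : 'M[R]_(n, q)) r s :
    pseries_diffs (fun k => (A ^+ k *m D) r s / k`!%:R) =
    (fun k => (A ^+ k *m (A *m D)) r s / k`!%:R).
  apply/funext => k; rewrite /pseries_diffs factS natrM mulmxA.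
  rewrite (_ : A ^+ k *m A = A ^+ k.+1) ?exprSr //.
  by rewrite invfM mulrCA mulVKf // pnatr_eq0.
have cE q (D : 'M[R]_(n, q)) r s t' :
    cvgn (pseries (fun k => (A ^+ k *m D) r s / k`!%:R) t').
  by apply/cvg_ex; eexists; exact: pseries_expmx_cvg.
(* Any radius larger than [|t|] would do; the power series converge everywhere. *)
have := @pseries_snd_diffs R (fun k => (A ^+ k *m C) i j / k`!%:R) (`|t| + 1) t.
rewrite !dE => /(_ (cE _ _ _ _ _) (cE _ _ _ _ _) (cE _ _ _ _ _)).
have -> : `|t| < `| `|t| + 1| by rewrite [ltRHS]ger0_norm ?addr_ge0 // ltrDl.
move=> /(_ isT).
rewrite (_ : (fun x => _) = (fun s : R => (expmx (s *: A) *m C) i j)).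
  by rewrite (cvg_lim _ (@pseries_expmx_cvg _ _ A (A *m C) i j t)).
by apply/funext => s; exact: (cvg_lim _ (@pseries_expmx_cvg _ _ A C i j s)).
Qed.

Lemma expmx0 n : expmx (0 : 'M[R]_n) = 1%:M.
Proof.
rewrite -[LHS]mul1mx (@expmx_left_eigen n n 1%:M 0 0) ?expR0 ?scale1r //.
by rewrite mulmx0 scale0r.
Qed.

(** Uniqueness for X' = X A: the product X(s) e^{(t-s)A} has zero derivative, and its values at s =
    0 and s = t are compared. The semigroup law and the effect of a scalar shift are both deduced
    from it. *)
Lemma expmx_ode m n (A : 'M[R]_n) (X : R -> 'M[R]_(m, n)) :
  (forall (t : R) i j, is_derive t 1 (fun s : R => X s i j) ((X t *m A) i j)) ->
  forall t, X t = X 0 *m expmx (t *: A).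
Proof.
move=> dX t; apply/matrixP => i j.
pose g (s : R) : R := (X s *m expmx ((t - s) *: A)) i j.
suff dg (s : R) : is_derive s (1 : R) g (0 : R).
  have := is_derive_0_is_cst t 0 dg.
  by rewrite /g subrr scale0r expmx0 mulmx1 subr0.
have -> : g = (fun s => \sum_l X s i l * expmx ((t - s) *: A) l j).
  by apply/funext => r; rewrite /g mxE.
have dE l : is_derive s 1 (fun r => expmx ((t - r) *: A) l j)
    (- (A *m expmx ((t - s) *: A)) l j).
  have d1 : is_derive (t - s) 1 (fun r : R => expmx (r *: A) l j)
      ((expmx ((t - s) *: A) *m A) l j).
    have := is_derive_expmx A 1%:M l j (t - s); rewrite mulmx1.
    by under [fun s : R => _]eq_fun do rewrite mulmx1.
  have d2 : is_derive s 1 (fun r : R => t - r) (- 1).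
    have d := is_deriveB (is_derive_cst t s (1 : R)) (is_derive_id s (1 : R)).
    by apply: (is_derive_eq d); rewrite sub0r.
  have := @is_derive1_comp R (fun r : R => expmx (r *: A) l j) (fun r : R => t - r) s _ _ d1 d2.
  move=> d3; apply: (is_derive_eq d3).
  by rewrite mulrN1 expmx_comm // -scalemxAr -scalemxAl.
have dS l : is_derive s 1 (fun r => X r i l * expmx ((t - r) *: A) l j)
   ((X s *m A) i l * expmx ((t - s) *: A) l j
     - X s i l * (A *m expmx ((t - s) *: A)) l j).
  have := is_deriveM (dX s i l) (dE l).
  move=> d3; apply: (is_derive_eq d3).
  by rewrite /GRing.scale /= mulrN addrC [X in X + _ = _]mulrC.
have := is_derive_sum dS.
rewrite (_ : \sum_(i0 < n) _ = (fun s => \sum_l X s i l * expmx ((t - s) *: A) l j)); last first.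
  by apply/funext => r; rewrite fct_sumE.
move=> d4; apply: (is_derive_eq d4).
rewrite sumrB.
have -> : \sum_l (X s *m A) i l * expmx ((t - s) *: A) l j =
  (X s *m A *m expmx ((t - s) *: A)) i j by rewrite [RHS]mxE.
have -> : \sum_l X s i l * (A *m expmx ((t - s) *: A)) l j =
  (X s *m (A *m expmx ((t - s) *: A))) i j by rewrite [RHS]mxE.
by rewrite mulmxA subrr.
Qed.

Lemma expmxD n (A : 'M[R]_n) s t :
  expmx ((s + t) *: A) = expmx (s *: A) *m expmx (t *: A).
Proof.
have := @expmx_ode n n A (fun r => expmx ((s + r) *: A)) _ t.
rewrite addr0; apply => r i j.
have d1 : is_derive (s + r) 1 (fun r : R => expmx (r *: A) i j)
    ((expmx ((s + r) *: A) *m A) i j).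
  have := is_derive_expmx A 1%:M i j (s + r); rewrite mulmx1.
  by under [fun s : R => _]eq_fun do rewrite mulmx1.
have d2 : is_derive r 1 (fun r : R => s + r) 1.
  have d := is_deriveD (is_derive_cst s r (1 : R)) (is_derive_id r (1 : R)).
  by apply: (is_derive_eq d); rewrite add0r.
have d3 := @is_derive1_comp R (fun r : R => expmx (r *: A) i j) (fun r : R => s + r) r _ _ d1 d2.
by apply: (is_derive_eq d3); rewrite mulr1.
Qed.

(** Reduces a matrix with nonnegative off-diagonal entries to an entrywise nonnegative one, for
    which the exponential is monotone. *)
Lemma expmx_shift n (A : 'M[R]_n) c t :
  expmx (t *: A) = expR (- c * t) *: expmx (t *: (A + c%:M)).
Proof.
apply/esym; have := @expmx_ode n n A (fun r => expR (- c * r) *: expmx (r *: (A + c%:M))) _ t.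
rewrite mulr0 expR0 scale1r scale0r expmx0 mul1mx; apply => r i j.
have d1 : is_derive r 1 (fun r : R => expmx (r *: (A + c%:M)) i j)
    ((expmx (r *: (A + c%:M)) *m (A + c%:M)) i j).
  have := is_derive_expmx (A + c%:M) 1%:M i j r; rewrite mulmx1.
  by under [fun s : R => _]eq_fun do rewrite mulmx1.
have d2 : is_derive r 1 (fun r : R => expR (- c * r)) (expR (- c * r) * - c).
  have d3 : is_derive r 1 (fun r : R => - c * r) (- c).
    have d := is_deriveZ (- c) (is_derive_id r (1 : R)).
    by apply: (is_derive_eq d); rewrite /GRing.scale /= mulr1.
  exact: (@is_derive1_comp R expR (fun r : R => - c * r) r _ _ (is_derive_expR _) d3).
have d3 := is_deriveM d2 d1.
rewrite (_ : (fun s : R => _) = (fun r => expR (- c * r)) *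
  (fun r => expmx (r *: (A + c%:M)) i j)); last by apply/funext => s; rewrite mxE.
apply: (is_derive_eq d3).
have -> : (expmx (r *: (A + c%:M)) *m (A + c%:M)) i j =
    (expmx (r *: (A + c%:M)) *m A) i j + c * expmx (r *: (A + c%:M)) i j.
  by rewrite mulmxDr mul_mx_scalar [LHS]mxE [X in _ + X]mxE.
rewrite -scalemxAl [RHS]mxE /GRing.scale /=; ring.
Qed.

End MatrixExponential.

(** * Growth rate of a nonnegative matrix *)

Section BoundedSequencesAlongUltrafilter.
Variable R : realType.

(** Limits along one ultrafilter give simultaneous limits of all coordinates of a bounded sequence
    of vectors, in place of nested subsequences. *)
Lemma bounded_ultra_cvg (U : set_system nat) (u : nat -> R) (a b : R) :
  UltraFilter U -> (forall k, a <= u k <= b) -> exists l : R, u k @[k --> U] --> l.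
Proof.
move=> UU uab; have /= := @segment_compact R a b.
rewrite compact_ultra => /(_ (fmap u U)) [].
- apply: Build_UltraFilter => G GF UG.
  apply/seteqP; split => A; last exact: UG.
  move=> GA; rewrite /fmap /=.
  have [//|UnA] := in_ultra_setVsetC (u @^-1` A) UU.
  have : G (~` A) by apply: UG.
  move=> /(filterI GA); rewrite setICr => G0.
  by have /filter_ex [] := G0.
- rewrite /fmap /=; apply: filterS filterT => k _ /=.
  by rewrite in_itv /=.
by move=> l [_ ul]; exists l.
Qed.

Lemma exists_ultra_eventually : exists U : set_system nat,
  UltraFilter U /\ (forall (u : nat -> R) (l : R), u @ \oo --> l -> u @ U --> l).
Proof.
have [U [UU ooU]] := @ultraFilterLemma nat \oo _.
exists U; split => // u l ul A /ul; rewrite /fmap /=; exact: ooU.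
Qed.

End BoundedSequencesAlongUltrafilter.

Section PerronFrobenius.
Variables (R : realType) (n : nat).
Implicit Types (M A : 'M[R]_n) (b eta : 'rV[R]_n) (v : 'cV[R]_n) (mu : R).

Lemma mulmx_ge0 m p q (A : 'M[R]_(m, p)) (B : 'M[R]_(p, q)) :
  (forall i j, 0 <= A i j) -> (forall i j, 0 <= B i j) ->
  forall i j, 0 <= (A *m B) i j.
Proof. by move=> A0 B0 i j; rewrite mxE sumr_ge0 // => k _; rewrite mulr_ge0. Qed.

Lemma ler_mulmxl m p q (A : 'M[R]_(m, p)) (B C : 'M[R]_(p, q)) :
  (forall i j, 0 <= A i j) -> (forall i j, B i j <= C i j) ->
  forall i j, (A *m B) i j <= (A *m C) i j.
Proof. by move=> A0 BC i j; rewrite !mxE ler_sum // => k _; rewrite ler_wpM2l. Qed.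

Lemma ler_mulmxr m p q (A : 'M[R]_(p, q)) (B C : 'M[R]_(m, p)) :
  (forall i j, 0 <= A i j) -> (forall i j, B i j <= C i j) ->
  forall i j, (B *m A) i j <= (C *m A) i j.
Proof. by move=> A0 BC i j; rewrite !mxE ler_sum // => k _; rewrite ler_wpM2r. Qed.

Definition supported_on b eta := forall i, b 0 i = 0 -> eta 0 i = 0.

(** In the graph with an arrow from [i] to [j] when [M i j] is nonzero, no arrow leaves the support
    of [b]. *)
Definition closed_support M b := forall i j, b 0 j = 0 -> b 0 i != 0 -> M i j = 0.

(** The row a e^M is positive exactly at the states reachable from the support of [a]: a zero at [j]
    forces every a M^k to vanish at [j], hence at each predecessor [i] of [j], and then the whole
    series vanishes at [i]. *)
Lemma expmx_closed_support M (a : 'rV[R]_n) : (forall i j, 0 <= M i j) ->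
  (forall i j, 0 <= a i j) -> closed_support M (a *m expmx M).
Proof.
move=> M0 a0 i j bj0 bi0.
have aM0 k r : 0 <= (a *m M ^+ k) 0 r.
  by apply: mulmx_ge0 => // s t; exact: exprmx_ge0.
have aMj0 k : (a *m M ^+ k) 0 j = 0.
  apply/eqP; rewrite eq_le aM0 andbT.
  pose t : 'M[R]_n := \matrix_(r, s) ((M ^+ k) r s / k`!%:R).
  have : (a *m t) 0 j <= (a *m expmx M) 0 j.
    by apply: ler_mulmxl => // r s; rewrite mxE; exact: expmx_ge_term.
  rewrite bj0.
  have -> : (a *m t) 0 j =
     (a *m M ^+ k) 0 j / k`!%:R.
    rewrite mxE [X in _ = X / _]mxE mulr_suml; apply: eq_bigr => s _; rewrite mxE; ring.
  by rewrite pmulr_lle0 // invr_gt0 ltr0n fact_gt0.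
apply/eqP; apply: contraNT bi0 => Mij0.
have aMi0 k : (a *m M ^+ k) 0 i = 0.
  have := aMj0 k.+1; rewrite exprSr -mulmxE mulmxA mxE.
  move/eqP; rewrite psumr_eq0 => [/allP /(_ i)|s _]; last by rewrite mulr_ge0.
  by rewrite mem_index_enum => /(_ isT); rewrite mulf_eq0 (negbTE Mij0) orbF => /eqP.
have h1 : (a *m expmx_part M N) 0 i @[N --> \oo] --> (a *m expmx M) 0 i.
  by apply: cvg_mulmxl => r s; exact: expmx_part_cvg.
rewrite -(cvg_lim _ h1) //.
rewrite (_ : (fun N => _) = cst 0) ?lim_cst //.
apply/funext => N; rewrite /expmx_part mulmx_sumr summxE big1 // => k _.
by rewrite -scalemxAr mxE aMi0 mulr0.
Qed.

Lemma supported_le b eta : (forall i, 0 <= b 0 i) -> (forall i, 0 <= eta 0 i) ->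
  supported_on b eta -> exists2 C, 0 < C & forall i, eta 0 i <= C * b 0 i.
Proof.
(* Quotients at zeros of [b] are 0 by the convention for division; the leading 1 only makes the
   constant positive. *)
move=> b0 e0 sb; exists (1 + \sum_i eta 0 i / b 0 i).
  by rewrite ltr_wpDr // sumr_ge0 // => i _; rewrite divr_ge0.
move=> i; have [bi0|bi0] := eqVneq (b 0 i) 0; first by rewrite bi0 mulr0 sb.
have bi : 0 < b 0 i by rewrite lt_def bi0 b0.
rewrite -ler_pdivrMr // (bigD1 i) //= addrCA lerDl addr_ge0 // sumr_ge0 // => j _.
by rewrite divr_ge0.
Qed.

(* The set of [mu] admitting a nonnegative supersolution is the half-line above
   the growth rate of [b *m M ^+ k]. *)
Definition supersolvable M b mu := exists2 eta : 'rV[R]_n,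
  (forall i, 0 <= eta 0 i) & forall i, (eta *m M) 0 i + b 0 i <= mu * eta 0 i.

Section GrowthRate.
Variables (M : 'M[R]_n) (b : 'rV[R]_n).
Hypothesis M_ge0 : forall i j, 0 <= M i j.
Hypothesis b_ge0 : forall i, 0 <= b 0 i.
Hypothesis b_neq0 : b != 0.
Hypothesis b_closed : closed_support M b.

Let b_pos : exists i, 0 < b 0 i.
Proof.
case/rV0Pn: b_neq0 => i bi; exists i.
by rewrite lt_def bi b_ge0.
Qed.

Let row_ge0 (eta : 'rV[R]_n) : (forall i, 0 <= eta 0 i) -> forall i j, 0 <= eta i j.
Proof. by move=> e0 i j; rewrite (ord1 i). Qed.

Lemma supersolvable_gt0 mu : supersolvable M b mu -> 0 < mu.
Proof.
move=> [eta e0 eM]; have [i bi] := b_pos.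
have : 0 < mu * eta 0 i.
  apply: lt_le_trans (eM i); rewrite ltr_wpDl //.
  by apply: mulmx_ge0 => //; exact: row_ge0.
rewrite ltNge => H; rewrite ltNge; apply: contraNN H => mu0.
by rewrite mulr_le0_ge0.
Qed.

(** Setting [eta] to zero off the support of [b] only lowers the left side on the support, and off
    the support closedness makes that side vanish. *)
Lemma supersolvable_truncate mu : supersolvable M b mu ->
  exists eta : 'rV[R]_n, [/\ forall i, 0 <= eta 0 i, supported_on b eta &
    forall i, (eta *m M) 0 i + b 0 i <= mu * eta 0 i].
Proof.
move=> [eta e0 eM].
exists (\row_i if b 0 i == 0 then 0 else eta 0 i); split.
- by move=> i; rewrite mxE; case: ifP.
- by move=> i bi; rewrite mxE bi eqxx.
move=> j; have [bj|bj] := eqVneq (b 0 j) 0.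
  rewrite [X in _ * X]mxE bj eqxx mulr0 addr0 mxE big1 // => i _.
  rewrite mxE; have [bi|bi] := eqVneq (b 0 i) 0; first by rewrite mul0r.
  by rewrite b_closed // mulr0.
rewrite [X in _ * X]mxE (negbTE bj); apply: le_trans (eM j).
rewrite lerD2r !mxE ler_sum // => i _; rewrite ler_wpM2r // mxE.
by case: ifP.
Qed.

(** Doubling a supersolution leaves a spare copy of [b]. Since [eta] is bounded by a multiple [C] of
    [b], this copy dominates C^-1 eta, which is the decrease of [mu] by (2C)^-1 applied to 2 eta. *)
Lemma supersolvable_open mu : supersolvable M b mu ->
  exists2 mu', mu' < mu & supersolvable M b mu'.
Proof.
move=> /supersolvable_truncate [eta [e0 sb eM]].
have [C C0 eC] := supported_le b_ge0 e0 sb.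
exists (mu - (2 * C)^-1).
  by rewrite ltrBlDr ltrDl invr_gt0 mulr_gt0.
exists (2 *: eta) => i; first by rewrite mxE mulr_ge0.
rewrite -scalemxAl !mxE.
have := eM i; rewrite mxE; have := eC i.
set s := \sum_j _; set x := eta 0 i; set y := b 0 i => xy sy.
have : C^-1 * x <= y by rewrite ler_pdivrMl.
rewrite mulrBl invfM; lra.
Qed.

Lemma supersolvable_up mu mu' : mu <= mu' -> supersolvable M b mu ->
  supersolvable M b mu'.
Proof.
move=> mm [eta e0 eM]; exists eta => // i; apply: le_trans (eM i) _.
by rewrite ler_wpM2r.
Qed.

(** The row [b] itself serves: by closedness b M lives on the support of [b], so it is at most a
    multiple of [b]. *)
Lemma supersolvable_nonempty : exists mu, supersolvable M b mu.
Proof.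
have [||C C0 bC] := @supported_le b (b *m M) b_ge0.
- by apply: mulmx_ge0 => //; exact: row_ge0.
- move=> j bj; rewrite mxE big1 // => i _.
  have [->|bi] := eqVneq (b 0 i) 0; first by rewrite mul0r.
  by rewrite b_closed // mulr0.
exists (C + 1); exists b => // i; rewrite mulrDl mul1r lerD2r //.
Qed.

(* The monotone iteration [eta |-> (eta *m M + b) / mu] turns a supersolution
   into a solution. *)
Lemma supersolvable_solution mu : supersolvable M b mu ->
  exists eta : 'rV[R]_n, [/\ forall i, 0 <= eta 0 i, supported_on b eta &
    eta *m M + b = mu *: eta].
Proof.
move=> E; have mu0 := supersolvable_gt0 E.
have [eta [e0 sb eM]] := supersolvable_truncate E.
pose F (x : 'rV[R]_n) : 'rV[R]_n := mu^-1 *: (x *m M + b).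
have Fmono (x y : 'rV[R]_n) : (forall i j, x i j <= y i j) -> forall i j, F x i j <= F y i j.
  move=> xy i j; rewrite 2!mxE [X in _ <= X]mxE [X in _ <= _ * X]mxE.
  by rewrite ler_wpM2l ?invr_ge0 ?(ltW mu0) // lerD2r; exact: ler_mulmxr.
pose e k := iter k F eta.
have ge0 k : forall i j, 0 <= e k i j.
  elim: k => [|k IH] i j; first exact: row_ge0.
  rewrite /e iterS 2!mxE mulr_ge0 ?invr_ge0 ?(ltW mu0) // addr_ge0 //.
    exact: mulmx_ge0.
  exact: row_ge0.
have decr k : forall i j, e k.+1 i j <= e k i j.
  elim: k => [|k IH] i j; last by rewrite /e !iterS; apply: Fmono.
  by rewrite (ord1 i) /e /= 2!mxE ler_pdivrMl.
have cv i j : exists l : R, e k i j @[k --> \oo] --> l.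
  apply/cvg_ex; apply: nonincreasing_is_cvgn.
    by apply/nonincreasing_seqP => k; exact: decr.
  by exists 0 => _ [k _ <-].
pose l : 'rV[R]_n := \matrix_(i, j) limn (fun k => e k i j).
have el i j : e k i j @[k --> \oo] --> l i j.
  by rewrite mxE; have [x ex] := cv i j; apply/cvg_ex; exists x.
have lle j : l 0 j <= eta 0 j.
  have := el 0 j => /cvg_lim <- //.
  apply: (@nonincreasing_cvgn_ge _ (fun k => e k 0 j) _ _ 0%N).
    by apply/nonincreasing_seqP => k; exact: decr.
  by apply/cvg_ex; exists (l 0 j).
have lge0 j : 0 <= l 0 j.
  have := el 0 j => /cvg_lim <- //; apply: limr_ge.
    by apply/cvg_ex; exists (l 0 j).
  by near=> k; exact: ge0.
exists l; split => //.
  by move=> i bi; apply/eqP; rewrite eq_le lge0 andbT -(sb _ bi) lle.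
apply/matrixP => i j.
have h1 : (e k *m M) i j + b i j @[k --> \oo] --> (l *m M) i j + b i j.
  by apply: cvgD (cvg_cst _); apply: cvg_mulmxr.
have h2 : mu * e k.+1 i j @[k --> \oo] --> mu * l i j.
  apply: cvgM; first exact: cvg_cst.
  by have := el i j; rewrite -(cvg_shiftS (fun k => e k i j)).
rewrite [LHS]mxE [RHS]mxE -(cvg_lim _ h1) // -(cvg_lim _ h2) //.
congr (limn _); apply/funext => k.
by rewrite /e iterS [X in _ = _ * X]mxE mulrA divff ?gt_eqF // mul1r [RHS]mxE.
Unshelve. all: by end_near. Qed.

(** For a nonzero [b] with closed support this is the spectral radius of [M] restricted to that
    support. *)
Definition growth_rate : R := inf [set mu | supersolvable M b mu].

Let has_inf_supersolvable : has_inf [set mu | supersolvable M b mu].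
Proof.
split; first by have [mu ?] := supersolvable_nonempty; exists mu.
by exists 0 => mu /supersolvable_gt0 /ltW.
Qed.

(** The strictness on the right is [supersolvable_open]: the infimum itself is excluded. The strict
    inequalities between decay rates originate here. *)
Lemma supersolvable_gtE mu : supersolvable M b mu <-> growth_rate < mu.
Proof.
split => [E|].
  have [mu' lt E'] := supersolvable_open E; apply: le_lt_trans lt.
  exact: (ge_inf has_inf_supersolvable.2).
move/(inf_lt has_inf_supersolvable.1) => [mu' E' lt].
exact: supersolvable_up (ltW lt) E'.
Qed.

(* Normalized solutions at levels decreasing to the growth rate accumulate at an
   eigenvector: the inhomogeneous term must vanish in the limit, since the growth
   rate itself is not supersolvable. *)
Lemma growth_rate_eigen : exists eta : 'rV[R]_n,
  [/\ forall i, 0 <= eta 0 i, eta != 0, supported_on b eta &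
      eta *m M = growth_rate *: eta].
Proof.
pose mu k : R := growth_rate + k.+1%:R^-1.
have sol k : exists eta : 'rV[R]_n, [/\ forall i, 0 <= eta 0 i,
    supported_on b eta & eta *m M + b = mu k *: eta].
  apply: supersolvable_solution; apply/supersolvable_gtE.
  by rewrite ltrDl invr_gt0.
have [e eP] := choice sol.
pose s k := \sum_i e k 0 i.
have [i0 bi0] := b_pos.
have rho0 : 0 <= growth_rate.
  apply: lb_le_inf; first exact: has_inf_supersolvable.1.
  by move=> m /supersolvable_gt0 /ltW.
have mu0 k : 0 < mu k by rewrite ltr_wpDl // invr_gt0.
have mule k : mu k <= growth_rate + 1.
  by rewrite lerD2l invf_le1 // ler1n.
pose r1 := growth_rate + 1.
have r10 : 0 < r1 by rewrite ltr_wpDl.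
(* The source [b] keeps the total mass away from zero, so the coefficient (s k)^-1 that multiplies
   [b] after normalization stays bounded and has a limit [kap]. *)
have sge k : b 0 i0 / r1 <= s k.
  have [e0 _ eM] := eP k.
  rewrite /s (bigD1 i0) //= -[leLHS]addr0 lerD ?sumr_ge0 //.
  have := congr1 (fun x : 'rV_n => x 0 i0) eM; rewrite !mxE => H.
  rewrite ler_pdivrMr // mulrC; apply: le_trans (_ : mu k * e k 0 i0 <= _).
    by rewrite -H lerDr sumr_ge0 // => j _; rewrite mulr_ge0.
  by rewrite ler_wpM2r.
have s0 k : 0 < s k by apply: lt_le_trans (sge k); rewrite divr_gt0.
have [U [UU ooU]] := exists_ultra_eventually R.
have ebd k i : 0 <= e k 0 i / s k <= 1.
  have [e0 _ _] := eP k.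
  rewrite divr_ge0 ?(ltW (s0 k)) //= ler_pdivrMr // mul1r /s (bigD1 i) //=.
  by rewrite lerDl sumr_ge0.
have kbd k : 0 <= (s k)^-1 <= (b 0 i0 / r1)^-1.
  by rewrite invr_ge0 ltW //= lef_pV2 ?posrE // divr_gt0.
have [h hP] := choice (fun i => bounded_ultra_cvg UU (ebd^~ i)).
have [kap kapP] := bounded_ultra_cvg UU kbd.
pose l : 'rV[R]_n := \row_i h i.
have lP i j : ((s k)^-1 *: e k) i j @[k --> U] --> l i j.
  rewrite (ord1 i) [X in _ --> X]mxE.
  rewrite (_ : (fun k => _) = (fun k => e k 0 j / s k)) //.
  by apply/funext => k; rewrite mxE mulrC.
have muP : mu k @[k --> U] --> growth_rate.
  apply: ooU; rewrite -[X in _ --> X]addr0; apply: cvgD; first exact: cvg_cst.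
  exact: cvg_harmonic.
have lge0 i : 0 <= l 0 i.
  have /cvg_lim <- // := lP 0 i; apply: limr_ge.
    by apply/cvg_ex; exists (l 0 i).
  apply: filterS filterT => k _; rewrite mxE mulrC.
  by case/andP: (ebd k i).
have kap0 : 0 <= kap.
  have /cvg_lim <- // := kapP; apply: limr_ge.
    by apply/cvg_ex; exists kap.
  by apply: filterS filterT => k _; case/andP: (kbd k).
have lsum : \sum_i l 0 i = 1.
  have h1 : \sum_i ((s k)^-1 *: e k) 0 i @[k --> U] --> \sum_i l 0 i.
    by apply: cvg_sumr => i; exact: lP.
  rewrite -(cvg_lim _ h1) // (_ : (fun k => _) = cst 1) ?lim_cst //.
  apply/funext => k; transitivity ((s k)^-1 * s k).
    by rewrite /s mulr_sumr; apply: eq_bigr => i _; rewrite mxE.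
  by rewrite mulVf // gt_eqF.
have lsupp : supported_on b l.
  move=> i bi; have /cvg_lim <- // := lP 0 i.
  rewrite (_ : (fun k => _) = cst 0) ?lim_cst //.
  by apply/funext => k; have [_ sb _] := eP k; rewrite mxE sb // mulr0.
have leq : l *m M + kap *: b = growth_rate *: l.
  apply/matrixP => i j.
  have h1 : ((s k)^-1 *: e k *m M) i j + (s k)^-1 * b i j @[k --> U] -->
      (l *m M) i j + kap * b i j.
    apply: cvgD; first exact: cvg_mulmxr.
    by apply: cvgM kapP _; exact: cvg_cst.
  have h2 : mu k * ((s k)^-1 *: e k) i j @[k --> U] --> growth_rate * l i j.
    exact: cvgM.
  rewrite [LHS]mxE [X in _ + X = _]mxE [RHS]mxE -(cvg_lim _ h1) // -(cvg_lim _ h2) //.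
  congr (lim (_ @ U)); apply/funext => k; have [_ _ eM] := eP k.
  rewrite -scalemxAl [X in X + _]mxE [X in _ = _ * X]mxE -mulrDr.
  have := congr1 (fun x : 'rV_n => x i j) eM.
  by rewrite [LHS]mxE [RHS]mxE => ->; rewrite mulrCA.
exists l; split => //.
  apply/eqP => l0; move: lsum; rewrite l0 big1 => [/esym/eqP|i _].
    by rewrite oner_eq0.
  by rewrite mxE.
have [k0|k0] := eqVneq kap 0; first by move: leq; rewrite k0 scale0r addr0.
have kpos : 0 < kap by rewrite lt_def k0.
suff : growth_rate < growth_rate by rewrite ltxx.
(* If [kap] were positive, rescaling the limit equation would restore the source [b] and solve the
   inequality at the growth rate itself. *)
apply/supersolvable_gtE; exists (kap^-1 *: l) => i.
  by rewrite mxE mulr_ge0 // invr_ge0.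
have := congr1 (fun x : 'rV_n => x 0 i) leq.
rewrite -scalemxAl !mxE => H.
rewrite mulrCA -H mulrDr mulrA mulVf // mul1r //.
Qed.

End GrowthRate.

End PerronFrobenius.

(** * Exponential decay *)

Section ExponentialDecay.
Variable R : realType.

(** The bounds are asymmetric on purpose: Jordan blocks can contribute polynomial factors, so an
    upper bound is only asked for at exponents below [theta]. Constants disappear after division by
    [t]. *)
Lemma log_rate_cvg (f : R -> R) (theta : R) :
  (exists2 c, 0 < c & forall t, 1 <= t -> c * expR (- theta * t) <= f t) ->
  (forall delta, delta < theta -> exists2 C, 0 < C &
     forall t, 0 <= t -> f t <= C * expR (- delta * t)) ->
  t^-1 * ln (f t) @[t --> +oo%R] --> - theta.
Proof.
move=> [c c0 lb] ub; apply/cvgrPdist_le => e e0.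
have e20 : 0 < e / 2 by rewrite divr_gt0.
(* Half of [e] pays for the loss in the exponent, the other half for the constant [C]. *)
have [|C C0 fC] := ub (theta - e / 2); first by rewrite ltrBlDr ltrDl.
near=> t.
have t1 : 1 <= t by near: t; apply: nbhs_pinfty_ge; rewrite num_real.
have t0 : 0 < t by apply: lt_le_trans t1.
have f0 : 0 < f t by apply: lt_le_trans (lb _ t1); rewrite mulr_gt0 // expR_gt0.
have l1 : ln c - theta * t <= ln (f t).
  have := lb _ t1; rewrite -ler_ln ?posrE ?mulr_gt0 ?expR_gt0 //.
  by rewrite lnM ?posrE ?expR_gt0 // expRK mulNr.
have l2 : ln (f t) <= ln C - (theta - e / 2) * t.
  have := fC _ (ltW t0); rewrite -ler_ln ?posrE ?mulr_gt0 ?expR_gt0 //.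
  by rewrite lnM ?posrE ?expR_gt0 // expRK mulNr.
have tc : `|ln c| / e <= t by near: t; apply: nbhs_pinfty_ge; rewrite num_real.
have tC : `|ln C| / (e / 2) <= t by near: t; apply: nbhs_pinfty_ge; rewrite num_real.
have c1 : - ln c <= t * e.
  by rewrite (le_trans (ler_norm _)) // normrN -ler_pdivrMr.
have C1 : ln C <= t * (e / 2).
  by rewrite (le_trans (ler_norm _)) // -ler_pdivrMr.
rewrite ler_norml; apply/andP; split.
  rewrite -(ler_pM2l t0) mulrBr mulrA divff ?gt_eqF // mul1r; nra.
rewrite -(ler_pM2l t0) mulrBr mulrA divff ?gt_eqF // mul1r; nra.
Unshelve. all: by end_near. Qed.

(** Iteration gives eta M^k <= mu^k eta, and the two exponential series are compared term by
    term. *)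
Lemma expmx_le_sub_eigen n (M : 'M[R]_n) (eta : 'rV[R]_n) mu t :
  (forall i j, 0 <= M i j) -> (forall i j, 0 <= eta i j) -> 0 <= mu -> 0 <= t ->
  (forall i j, (eta *m M) i j <= mu * eta i j) ->
  forall i j, (eta *m expmx (t *: M)) i j <= expR (mu * t) * eta i j.
Proof.
move=> M0 e0 mu0 t0 eM i j.
have Mk k : forall r s, (eta *m M ^+ k) r s <= mu ^+ k * eta r s.
  elim: k => [|k IH] r s; first by rewrite !expr0 mulmx1 mul1r.
  rewrite exprSr -mulmxE mulmxA.
  apply: le_trans (_ : ((mu ^+ k *: eta) *m M) r s <= _).
    by apply: ler_mulmxr => // p q; rewrite [leRHS]mxE.
  rewrite -scalemxAl mxE exprSr -mulrA ler_wpM2l //; exact: exprn_ge0.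
have h1 : (eta *m expmx_part (t *: M) N) i j @[N --> \oo] -->
    (eta *m expmx (t *: M)) i j.
  by apply: cvg_mulmxl => r s; exact: expmx_part_cvg.
have h2 : series (exp_coeff (mu * t)) N * eta i j @[N --> \oo] -->
    expR (mu * t) * eta i j.
  by apply: cvgM; [exact: is_cvg_series_exp_coeff|exact: cvg_cst].
rewrite -(cvg_lim _ h1) // -(cvg_lim _ h2) //; apply: ler_lim.
- by apply/cvg_ex; eexists; exact: h1.
- by apply/cvg_ex; eexists; exact: h2.
near=> N; rewrite /expmx_part mulmx_sumr summxE /series /= mulr_suml.
apply: ler_sum => k _; rewrite exprmxZ scalerA -scalemxAr mxE.
rewrite (_ : exp_coeff _ k = (mu * t) ^+ k / k`!%:R) // exprMn.
apply: le_trans (_ : k`!%:R^-1 * t ^+ k * (mu ^+ k * eta i j) <= _).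
  by rewrite ler_wpM2l // mulr_ge0 ?invr_ge0 ?exprn_ge0.
by rewrite le_eqVlt; apply/orP; left; apply/eqP; ring.
Unshelve. all: by end_near. Qed.

Section Rate.
Variables (n : nat) (A : 'M[R]_n) (c : R) (a : 'rV[R]_n).

(* [c] only serves to make [A + c%:M] entrywise nonnegative, and the factor
   [expmx] makes the set of states reachable from [a] visible as a support. *)
Definition decay_exponent : R :=
  c - growth_rate (A + c%:M) (a *m expmx (A + c%:M)).

Hypothesis A_ge0 : forall i j, 0 <= (A + c%:M) i j.
Hypothesis a_ge0 : forall i, 0 <= a 0 i.
Hypothesis a_neq0 : a != 0.

Let M := A + c%:M.
Let b := a *m expmx M.

Let a_ge0' : forall i j, 0 <= a i j.
Proof. by move=> i j; rewrite (ord1 i). Qed.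

Let b_ge0 : forall i, 0 <= b 0 i.
Proof. by apply: mulmx_ge0 => // i j; exact: expmx_ge0. Qed.

Let a_le_b i : a 0 i <= b 0 i.
Proof.
rewrite -{1}[a]mulmx1; apply: ler_mulmxl => // r s.
have := expmx_ge_term r s 0 A_ge0.
by rewrite expr0 fact0 divr1.
Qed.

Let b_neq0 : b != 0.
Proof.
case/rV0Pn: a_neq0 => i ai; apply/rV0Pn; exists i.
by rewrite gt_eqF // (lt_le_trans _ (a_le_b i)) // lt_def ai a_ge0.
Qed.

Let b_closed : closed_support M b.
Proof. exact: expmx_closed_support. Qed.

(** Multiplying a supersolution with source [a] by e^M, which is nonnegative and commutes with [M],
    turns it into a supersolution with source [b]. *)
Lemma decay_exponent_gt mu (eta : 'rV[R]_n) : (forall i, 0 <= eta 0 i) ->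
  (forall i, (eta *m A) 0 i + a 0 i <= - mu * eta 0 i) ->
  mu < decay_exponent.
Proof.
move=> e0 eA; rewrite /decay_exponent ltrBrDl addrC -ltrBrDl.
apply/(supersolvable_gtE A_ge0 b_ge0 b_neq0 b_closed).
have e0' i j : 0 <= eta i j by rewrite (ord1 i).
exists (eta *m expmx M) => i.
  by apply: mulmx_ge0 => // r s; exact: expmx_ge0.
have -> : eta *m expmx M *m (A + c%:M) = (eta *m (A + c%:M)) *m expmx M.
  by rewrite -!mulmxA expmx_comm.
apply: le_trans (_ : (((c - mu) *: eta) *m expmx M) 0 i <= _); last first.
  by rewrite -scalemxAl mxE.
apply: le_trans (_ : ((eta *m (A + c%:M) + a) *m expmx M) 0 i <= _).
  by rewrite mulmxDl [leRHS]mxE.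
apply: ler_mulmxr => [r s|r s]; first exact: expmx_ge0.
rewrite (ord1 r) mulmxDr mul_mx_scalar; have := eA s.
by move: (eta *m A) => x; rewrite !mxE; lra.
Qed.

Lemma decay_exponent_eigen : exists eta : 'rV[R]_n,
  [/\ forall i, 0 <= eta 0 i, eta != 0 & eta *m A = - decay_exponent *: eta].
Proof.
have [eta [e0 en0 _ eM]] := growth_rate_eigen A_ge0 b_ge0 b_neq0 b_closed.
exists eta; split => //.
rewrite /decay_exponent opprB scalerBl -eM mulmxDr mul_mx_scalar.
by rewrite addrK.
Qed.

Variable v : 'cV[R]_n.
Hypothesis v_gt0 : forall i, 0 < v i 0.

Let v_ge0 : forall i j, 0 <= v i j.
Proof. by move=> i j; rewrite (ord1 j) ltW. Qed.

Let f (t : R) : R := (a *m expmx (t *: A) *m v) 0 0.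

Let fE t : f t = expR (- c * t) * (a *m expmx (t *: M) *m v) 0 0.
Proof. by rewrite /f (expmx_shift _ c) -scalemxAr -scalemxAl mxE. Qed.

Let tM_ge0 t : 0 <= t -> forall i j, 0 <= (t *: M) i j.
Proof. by move=> t0 i j; rewrite mxE mulr_ge0. Qed.

(** The eigenvector is below a multiple of [b] = a e^M, which is the state at time 1. Hence a e^{tM}
    is compared with eta e^{(t-1)M}; this explains both [1 <= t] and the factor [expR (- rho)] in
    the constant. *)
Lemma decay_lower_bound : exists2 k, 0 < k &
  forall t, 1 <= t -> k * expR (- decay_exponent * t) <= f t.
Proof.
have [eta [e0 en0 es eM]] := growth_rate_eigen A_ge0 b_ge0 b_neq0 b_closed.
have [C C0 eC] := supported_le b_ge0 e0 es.
have e0' i j : 0 <= eta i j by rewrite (ord1 i).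
set rho := growth_rate _ _ in eM.
pose w := (eta *m v) 0 0.
have w0 : 0 < w.
  case/rV0Pn: en0 => i ei; rewrite /w mxE (bigD1 i) //= ltr_pwDl //.
    by rewrite mulr_gt0 // lt_def ei e0.
  by rewrite sumr_ge0 // => j _; rewrite mulr_ge0.
exists (C^-1 * w * expR (- rho)); first by rewrite !mulr_gt0 ?invr_gt0 ?expR_gt0.
move=> t t1; rewrite fE.
have t10 : 0 <= t - 1 by rewrite subr_ge0.
have : C^-1 * (expR (rho * (t - 1)) * w) <= (b *m expmx ((t - 1) *: M) *m v) 0 0.
  rewrite ler_pdivrMl //.
  have -> : expR (rho * (t - 1)) * w = (eta *m expmx ((t - 1) *: M) *m v) 0 0.
    rewrite (@expmx_left_eigen _ _ _ eta _ (rho * (t - 1))).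
      by rewrite -scalemxAl mxE.
    by rewrite -scalemxAr eM scalerA mulrC.
  have -> : C * (b *m expmx ((t - 1) *: M) *m v) 0 0 =
      (C *: b *m expmx ((t - 1) *: M) *m v) 0 0.
    by rewrite -!scalemxAl [RHS]mxE.
  apply: ler_mulmxr => // i j; apply: ler_mulmxr => r s.
    by apply: expmx_ge0; exact: tM_ge0.
  by rewrite (ord1 r) [leRHS]mxE.
have -> : b *m expmx ((t - 1) *: M) = a *m expmx (t *: M).
  by rewrite /b -mulmxA -{1}[M]scale1r -expmxD addrC subrK.
move=> H; rewrite -ler_pdivrMl ?expR_gt0 // (le_trans _ H) // le_eqVlt.
apply/orP; left; apply/eqP.
rewrite /decay_exponent -/rho.
have -> : - (c - rho) * t = - c * t + rho * t by ring.
have -> : rho * (t - 1) = rho * t - rho by ring.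
rewrite !expRD; field.
by rewrite !gt_eqF // expR_gt0.
Qed.

(** A supersolution at level mu = c - delta dominates the source, a <= b <= mu eta, and satisfies
    eta M <= mu eta, so it grows at most like e^{mu t}. *)
Lemma decay_upper_bound delta : delta < decay_exponent -> exists2 C, 0 < C &
  forall t, 0 <= t -> f t <= C * expR (- delta * t).
Proof.
move=> d; have E : supersolvable M b (c - delta).
  apply/supersolvable_gtE => //.
  by move: d; rewrite /decay_exponent -/M -/b; lra.
have mu0 := supersolvable_gt0 A_ge0 b_ge0 b_neq0 E.
have [eta e0 eM] := E.
have e0' i j : 0 <= eta i j by rewrite (ord1 i).
set mu := c - delta in E mu0 eM.
pose w := (eta *m v) 0 0.
have w0 : 0 <= w by apply: mulmx_ge0.
exists (1 + mu * w); first by rewrite ltr_wpDr // mulr_ge0 // ltW.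
move=> t t0; rewrite fE.
apply: le_trans (_ : expR (- c * t) * (mu * (expR (mu * t) * w)) <= _).
  rewrite ler_wpM2l ?expR_ge0 //.
  apply: le_trans (_ : ((mu *: eta) *m expmx (t *: M) *m v) 0 0 <= _).
    apply: ler_mulmxr => // i j; apply: ler_mulmxr => r s.
      by apply: expmx_ge0; exact: tM_ge0.
    rewrite (ord1 r) mxE (le_trans (a_le_b s)) // (le_trans _ (eM s)) // lerDr.
    exact: mulmx_ge0.
  rewrite -!scalemxAl mxE ler_wpM2l ?(ltW mu0) //.
  have -> : expR (mu * t) * w = ((expR (mu * t) *: eta) *m v) 0 0.
    by rewrite -scalemxAl mxE.
  apply: ler_mulmxr => // i j; rewrite [leRHS]mxE.
  apply: expmx_le_sub_eigen => //; first exact: ltW.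
  by move=> r s; rewrite (ord1 r) (le_trans _ (eM s)) // lerDl.
have -> : - delta * t = - c * t + mu * t by rewrite /mu; ring.
rewrite expRD.
have -> : expR (- c * t) * (mu * (expR (mu * t) * w)) =
  (mu * w) * (expR (- c * t) * expR (mu * t)) by ring.
by rewrite ler_wpM2r ?mulr_ge0 ?expR_ge0 // lerDr.
Qed.

Lemma decay_exponent_cvg : t^-1 * ln (f t) @[t --> +oo%R] --> - decay_exponent.
Proof.
by apply: log_rate_cvg; [exact: decay_lower_bound|exact: decay_upper_bound].
Qed.

Lemma phase_tail_gt0 t : 0 <= t -> 0 < f t.
Proof.
move=> t0; rewrite fE mulr_gt0 ?expR_gt0 //.
apply: lt_le_trans (_ : (a *m v) 0 0 <= _).
  case/rV0Pn: a_neq0 => i ai; rewrite mxE (bigD1 i) //= ltr_pwDl //.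
    by rewrite mulr_gt0 // lt_def ai a_ge0.
  by rewrite sumr_ge0 // => j _; rewrite mulr_ge0.
apply: ler_mulmxr => // i j; rewrite -{1}[a]mulmx1; apply: ler_mulmxl => // r s.
have := expmx_ge_term r s 0 (tM_ge0 t0).
by rewrite expr0 fact0 divr1.
Qed.

End Rate.
End ExponentialDecay.

(** * Subgenerators and their rank-one updates *)

Section SubgeneratorInverse.
Variable R : realType.

(** Minimum principle for u = (-S)^-1 1, the vector of mean absorption times: at a minimal
    coordinate with value <= 0, the row of S u would be at least that value times a nonpositive row
    sum, hence >= 0, whereas S u = -1. *)
Lemma subgenerator_inv_gt0 n (S : 'M[R]_n) : subgenerator S -> S \in unitmx ->
  forall i, 0 < (invmx (- S) *m (const_mx 1 : 'cV[R]_n)) i 0.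
Proof.
move=> [Sd So Sr] Su i; set u := _ *m _.
have NSu : - S \in unitmx by rewrite unitmxE -scaleN1r detZ unitrM unitrX ?unitrN1.
have Suj j : \sum_k S j k * u k 0 = - 1.
  have := congr1 (fun x : 'cV[R]_n => x j 0) (mulKVmx NSu (const_mx 1 : 'cV[R]_n)).
  rewrite -/u mulNmx [LHS]mxE mxE [RHS]mxE => <-; by rewrite opprK.
case: (@arg_minP _ _ _ i xpredT (fun k => u k 0) isT) => j _ jmin.
apply: lt_le_trans (jmin i isT); rewrite ltNge; apply/negP => uj.
suff : 0 <= \sum_k S j k * u k 0 by rewrite Suj oppr_ge0 ler10.
apply: le_trans (_ : \sum_k S j k * u j 0 <= _).
  by rewrite -mulr_suml mulr_le0.
apply: ler_sum => k _; have [->//|kj] := eqVneq k j.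
by rewrite ler_wpM2l ?jmin // So // eq_sym.
Qed.

Lemma subgenerator_shift_ge0 n (S : 'M[R]_n) c : subgenerator S -> mxsum S <= c ->
  forall i j, 0 <= (S + c%:M) i j.
Proof.
move=> [Sd So Sr] Sc i j; rewrite !mxE.
have [->|ij] := eqVneq i j; last by rewrite mulr0n addr0 So.
rewrite mulr1n -lerBlDl sub0r (le_trans (ler_norm _)) // normrN.
exact: le_trans (norm_le_mxsum S j j) Sc.
Qed.

Lemma probability_vector_neq0 n (a : 'rV[R]_n) : probability_vector a -> a != 0.
Proof.
move=> [_ a1]; apply/eqP => a0; move: a1; rewrite a0 big1 => [/esym/eqP|i _].
  by rewrite oner_eq0.
by rewrite mxE.
Qed.

Lemma mixture_subgenerator n1 n2 (S1 : 'M[R]_n1) (S2 : 'M[R]_n2) :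
  subgenerator S1 -> subgenerator S2 -> subgenerator (mixture_matrix S1 S2).
Proof.
move=> [d1 o1 r1] [d2 o2 r2]; split.
- by move=> i; case: (split_ordP i) => k ->; rewrite ?block_mxEul ?block_mxEdr.
- move=> i j; case: (split_ordP i) => k ->; case: (split_ordP j) => l ->.
  + by rewrite block_mxEul => kl; apply: o1; apply: contraNneq kl => ->.
  + by rewrite block_mxEur mxE.
  + by rewrite block_mxEdl mxE.
  + by rewrite block_mxEdr => kl; apply: o2; apply: contraNneq kl => ->.
- move=> i; rewrite big_split_ord /=; case: (split_ordP i) => k ->.
    rewrite [X in _ + X]big1 ?addr0 => [|j _]; last by rewrite block_mxEur mxE.
    by under eq_bigr do rewrite block_mxEul.
  rewrite [X in X + _]big1 ?add0r => [|j _]; last by rewrite block_mxEdl mxE.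
  by under eq_bigr do rewrite block_mxEdr.
Qed.

Lemma mixture_unitmx n1 n2 (S1 : 'M[R]_n1) (S2 : 'M[R]_n2) :
  S1 \in unitmx -> S2 \in unitmx -> mixture_matrix S1 S2 \in unitmx.
Proof. by rewrite !unitmxE det_ublock unitrM => -> ->. Qed.

Lemma mixture_probability_vector n1 n2 p (a1 : 'rV[R]_n1) (a2 : 'rV[R]_n2) :
  0 < p < 1 -> probability_vector a1 -> probability_vector a2 ->
  probability_vector (mixture_vector p a1 a2).
Proof.
move=> /andP[p0 p1] [a10 a11] [a20 a21]; split.
  move=> i; case: (split_ordP i) => k ->; rewrite ?row_mxEl ?row_mxEr mxE.
    by rewrite mulr_ge0 // ltW.
  by rewrite mulr_ge0 // subr_ge0 ltW.
rewrite big_split_ord /=.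
under eq_bigr do rewrite row_mxEl mxE.
under [X in _ + X]eq_bigr do rewrite row_mxEr mxE.
by rewrite -!mulr_sumr a11 a21; ring.
Qed.

Lemma mixture_expmx n1 n2 (S1 : 'M[R]_n1) (S2 : 'M[R]_n2) t :
  expmx (t *: mixture_matrix S1 S2) =
  block_mx (expmx (t *: S1)) 0 0 (expmx (t *: S2)).
Proof.
have pw k : (t *: mixture_matrix S1 S2) ^+ k =
    block_mx ((t *: S1) ^+ k) 0 0 ((t *: S2) ^+ k).
  elim: k => [|k IH]; first by rewrite !expr0 -scalar_mx_block.
  rewrite !exprS IH -!mulmxE /mixture_matrix scale_block_mx !scaler0.
  by rewrite mulmx_block !(mul0mx, mulmx0, addr0, add0r).
apply/matrixP => i j; rewrite mxE.
case: (split_ordP i) => k ->; case: (split_ordP j) => l ->.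
- by rewrite block_mxEul mxE; under eq_fun do rewrite pw block_mxEul.
- rewrite block_mxEur mxE; under eq_fun do rewrite pw block_mxEur mxE mul0r.
  by apply: lim_near_cst => //; near=> N; rewrite /series /= big1.
- rewrite block_mxEdl mxE; under eq_fun do rewrite pw block_mxEdl mxE mul0r.
  by apply: lim_near_cst => //; near=> N; rewrite /series /= big1.
- by rewrite block_mxEdr mxE; under eq_fun do rewrite pw block_mxEdr.
Unshelve. all: by end_near. Qed.

Lemma mixture_total_mass n1 n2 p (a1 : 'rV[R]_n1) (a2 : 'rV[R]_n2)
    (S1 : 'M[R]_n1) (S2 : 'M[R]_n2) t :
  total_mass (mixture_vector p a1 a2 *m expmx (t *: mixture_matrix S1 S2)) =
  p * total_mass (a1 *m expmx (t *: S1)) +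
  (1 - p) * total_mass (a2 *m expmx (t *: S2)).
Proof.
rewrite mixture_expmx /mixture_vector mul_row_block !mulmx0 addr0 add0r.
rewrite /total_mass -col_mx_const mul_row_col -!scalemxAl mxE.
by rewrite [X in X + _]mxE [X in _ + X]mxE.
Qed.

End SubgeneratorInverse.

Section RankOneUpdate.
Variables (R : realType) (n : nat) (S : 'M[R]_n) (a : 'rV[R]_n) (lambda : R).
Hypothesis S_subgen : subgenerator S.
Hypothesis S_unit : S \in unitmx.
Hypothesis a_prob : probability_vector a.
Hypothesis lambda01 : 0 < lambda < 1.

Let one : 'cV[R]_n := const_mx 1.
Let U := invmx (- S).
Let u := U *m one.
Let T := S + lambda *: (one *m a).

Hypothesis mean1 : (a *m u) 0 0 = 1.

Let au1 : a *m u = 1%:M.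
Proof. by apply/matrixP => i j; rewrite (ord1 i) (ord1 j) mean1 mxE. Qed.

Let NS_unit : - S \in unitmx.
Proof. by rewrite unitmxE -scaleN1r detZ unitrM unitrX ?unitrN1. Qed.

(** S u = -1, and the rank-one part contributes lambda 1 because a u = 1. Invertibility of [T], the
    second form of the tail and theta_Z > 0 all rest on this identity. *)
Lemma rank_one_update_mul_mean : T *m u = - (1 - lambda) *: one.
Proof.
rewrite mulmxDl -scalemxAl -mulmxA au1 mulmx1 -[S]opprK mulNmx.
by rewrite mulKVmx // opprB scalerBl scale1r addrC.
Qed.

Lemma rank_one_update_unitmx : - T \in unitmx.
Proof.
have l1 : 1 - lambda != 0 by rewrite subr_eq0 eq_sym lt_eqF; case/andP: lambda01.
(* The Sherman-Morrison inverse; its denominator is 1 - lambda a (-S)^-1 1 = 1 - lambda. *)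
pose V := U + (lambda / (1 - lambda)) *: (u *m (a *m U)).
suff /mulmx1_unit[] : - T *m V = 1%:M by [].
rewrite mulmxDr -scalemxAr mulmxA [- T *m u]mulNmx rank_one_update_mul_mean.
rewrite -scaleNr opprK -scalemxAl scalerA divfK //.
rewrite mulNmx mulmxDl opprD -mulNmx mulmxV // -scalemxAl mulmxA.
by rewrite subrK.
Qed.

Lemma rank_one_update_inv : invmx (- T) *m one = (1 - lambda)^-1 *: u.
Proof.
have l1 : 1 - lambda != 0 by rewrite subr_eq0 eq_sym lt_eqF; case/andP: lambda01.
have -> : one = (1 - lambda)^-1 *: (- T *m u).
  by rewrite mulNmx rank_one_update_mul_mean -scaleNr opprK scalerA mulVf // scale1r.
by rewrite -scalemxAr mulKmx // rank_one_update_unitmx.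
Qed.

Lemma workload_tail_two_forms t :
  lambda * total_mass (a *m expmx (t *: T) *m invmx (- S)) =
  lambda * total_mass (((1 - lambda) *: a) *m expmx (t *: T) *m invmx (- T)).
Proof.
have l1 : 1 - lambda != 0 by rewrite subr_eq0 eq_sym lt_eqF; case/andP: lambda01.
congr (_ * _); rewrite /total_mass -/one -[_ *m invmx (- T) *m one]mulmxA.
rewrite rank_one_update_inv.
by rewrite -!scalemxAl -scalemxAr scalerA divff // scale1r -mulmxA.
Qed.

Lemma rank_one_update_shift_ge0 c : mxsum S <= c ->
  forall i j, 0 <= (T + c%:M) i j.
Proof.
move=> Sc i j; have := subgenerator_shift_ge0 S_subgen Sc i j.
rewrite /T addrAC => H; rewrite mxE addr_ge0 // mxE mulr_ge0 //.
  by case/andP: lambda01 => /ltW.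
by rewrite mxE sumr_ge0 // => k _; rewrite (ord1 k) /one mxE mul1r; case: a_prob.
Qed.

(* A left eigenvector of [T], normalized, solves the resolvent equation of [S]
   with source [a]. *)
Lemma workload_decay_exponent c : mxsum S <= c ->
  0 < decay_exponent T c a /\
  exists2 eta : 'rV[R]_n, (forall i, 0 <= eta 0 i) &
    eta *m S + a = - decay_exponent T c a *: eta.
Proof.
move=> Sc; have [l0 l1] := andP lambda01.
have [a0 _] := a_prob.
have [eta [e0 en0 eT]] := decay_exponent_eigen (rank_one_update_shift_ge0 Sc) a0
  (probability_vector_neq0 a_prob).
set th := decay_exponent _ _ _ in eT *.
have pos (v : 'cV[R]_n) : (forall i, 0 < v i 0) -> 0 < (eta *m v) 0 0.
  move=> v0; case/rV0Pn: en0 => i ei; rewrite mxE (bigD1 i) //= ltr_pwDl //.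
    by rewrite mulr_gt0 // lt_def ei e0.
  by rewrite sumr_ge0 // => j _; rewrite mulr_ge0 // ltW.
have e1 : 0 < (eta *m one) 0 0 by apply: pos => i; rewrite mxE.
have eu : 0 < (eta *m u) 0 0 by apply: pos; exact: subgenerator_inv_gt0.
split.
  have : (1 - lambda) * (eta *m one) 0 0 = th * (eta *m u) 0 0.
    have := congr1 (fun x => x *m u) eT.
    rewrite -mulmxA rank_one_update_mul_mean -scalemxAr -scalemxAl.
    move/matrixP => /(_ 0 0); rewrite [LHS]mxE [RHS]mxE !mulNr.
    by move/oppr_inj.
  move=> H; rewrite -(pmulr_lgt0 _ eu) -H mulr_gt0 // subr_gt0 //.
set k := lambda * (eta *m one) 0 0.
have k0 : 0 < k by rewrite mulr_gt0.
exists (k^-1 *: eta) => [i|]; first by rewrite mxE mulr_ge0 // invr_ge0 ltW.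
rewrite scalerA mulrC -scalerA -eT -scalemxAl mulmxDr -scalemxAr mulmxA.
rewrite scalerDr scalerA; congr (_ + _).
have -> : eta *m one = ((eta *m one) 0 0)%:M.
  by apply/matrixP => i j; rewrite (ord1 i) (ord1 j) [RHS]mxE eqxx mulr1n.
by rewrite mul_scalar_mx scalerA -mulrA mulVf ?scale1r // gt_eqF.
Qed.

End RankOneUpdate.

(** * Evolution of the workload tail with the level *)

Section QuadraticIncrements.
Variable R : realType.

Lemma exp_bounded_cvg0 (f : R -> R) C delta : 0 < delta ->
  (forall t, 0 <= t -> 0 <= f t <= C * expR (- delta * t)) ->
  f t @[t --> +oo%R] --> 0.
Proof.
move=> d0 fC.
have e0 : C * expR (- (delta * t)) @[t --> +oo%R] --> 0.
  rewrite -[X in _ --> X](mulr0 C); apply: cvgM; first exact: cvg_cst.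
  apply: (cvg_comp (fun t => delta * t) (fun t => expR (- t)) _ (@cvgr_expR R)).
  by apply: gt0_cvgMry => //; exact: cvg_id.
apply: (squeeze_cvgr _ (cvg_cst 0) e0); near=> t.
rewrite -mulNr; apply: fC; near: t; apply: nbhs_pinfty_ge; rewrite num_real //.
Unshelve. all: by end_near. Qed.

(** Over [N] steps of length K/N the increments add up to at most C K^2 / N. This replaces a
    zero-derivative argument for functions of unknown regularity. *)
Lemma quadratic_increments_cst (f : R -> R) (K C : R) : 0 <= K ->
  (forall x h, 0 <= x -> 0 <= h <= 1 -> x + h <= K ->
     `|f (x + h) - f x| <= C * h ^+ 2) ->
  f K = f 0.
Proof.
move=> K0 fC; apply/eqP; rewrite -subr_eq0 -normr_le0.
apply/ler_addgt0Pr => e e0; rewrite add0r.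
near \oo => N.
have N0 : (0 < N)%N by near: N; exact: nbhs_infty_gt.
have N0' : 0 < N%:R :> R by rewrite ltr0n.
have NK : K <= N%:R by near: N; exact: nbhs_infty_ger.
have NC : C * K ^+ 2 / e <= N%:R by near: N; exact: nbhs_infty_ger.
pose h := K / N%:R.
have h0 : 0 <= h by rewrite divr_ge0 // ltW.
have h1 : h <= 1 by rewrite ler_pdivrMr // mul1r.
have -> : f K - f 0 = \sum_(0 <= k < N) (f (k.+1%:R * h) - f (k%:R * h)).
  rewrite (telescope_sumr (fun k => f (k%:R * h))) //.
  by rewrite mul0r /h mulrC divfK // gt_eqF.
apply: le_trans (ler_norm_sum _ _ _) _.
apply: le_trans (_ : \sum_(0 <= k < N) C * h ^+ 2 <= _).
  apply: ler_sum_nat => k /= kN.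
  have -> : k.+1%:R * h = k%:R * h + h by rewrite -natr1 mulrDl mul1r.
  apply: fC; [by rewrite mulr_ge0|by rewrite h0|].
  have -> : k%:R * h + h = K * (k.+1%:R / N%:R) by rewrite /h -natr1; ring.
  by rewrite ler_piMr // ler_pdivrMr // mul1r ler_nat.
rewrite sumr_const_nat subn0 -mulr_natl /h.
have -> : N%:R * (C * (K / N%:R) ^+ 2) = C * K ^+ 2 / N%:R.
  by field; rewrite gt_eqF.
by rewrite ler_pdivrMr // [e * _]mulrC -ler_pdivrMr.
Unshelve. all: by end_near. Qed.

Lemma mxsumZ m n (A : 'M[R]_(m, n)) t : mxsum (t *: A) = `|t| * mxsum A.
Proof.
rewrite /mxsum mulr_sumr; apply: eq_bigr => i _.
by rewrite mulr_sumr; apply: eq_bigr => j _; rewrite mxE normrM.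
Qed.

Lemma mulmx_norm_le m n p (A : 'M[R]_(m, n)) (B : 'M[R]_(n, p)) c i j :
  0 <= c -> (forall k, `|A i k| <= c) -> `|(A *m B) i j| <= c * mxsum B.
Proof.
move=> c0 Ac; rewrite mxE (le_trans (ler_norm_sum _ _ _)) //.
apply: le_trans (_ : c * \sum_k `|B k j| <= _).
  rewrite mulr_sumr; apply: ler_sum => k _.
  by rewrite normrM ler_wpM2r.
rewrite ler_wpM2l // /mxsum; apply: ler_sum => k _.
by rewrite (bigD1 j) //= lerDl sumr_ge0.
Qed.

Lemma expmx_mxsum_le n (A : 'M[R]_n) s K : 0 <= s <= K ->
  mxsum (expmx (s *: A)) <= (n * n)%:R * expR (K * mxsum A).
Proof.
move=> /andP[s0 sK]; rewrite /mxsum.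
apply: le_trans (_ : \sum_(i < n) \sum_(j < n) expR (K * mxsum A) <= _).
  apply: ler_sum => i _; apply: ler_sum => j _.
  apply: le_trans (expmx_norm _ _ _) _.
  by rewrite ler_expR mxsumZ ger0_norm // ler_wpM2r // mxsum_ge0.
by rewrite !sumr_const !card_ord -mulrnA mulr_natl.
Qed.

End QuadraticIncrements.

(* [W] stands for the tail of the workload and [m x] for the expected phase, at
   level [x], of the overshooting job. *)
Section WorkloadTail.
Variables (R : realType) (n : nat) (S : 'M[R]_n) (a : 'rV[R]_n) (lambda : R).
Hypothesis S_subgen : subgenerator S.
Hypothesis S_unit : S \in unitmx.
Hypothesis a_prob : probability_vector a.
Hypothesis lambda01 : 0 < lambda < 1.

Let one : 'cV[R]_n := const_mx 1.
Let u := invmx (- S) *m one.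
Let T := S + lambda *: (one *m a).

Hypothesis mean1 : (a *m u) 0 0 = 1.

Variables (W : R -> R) (m : R -> 'rV[R]_n) (C B : R).
Hypothesis C_ge0 : 0 <= C.
Hypothesis B_ge0 : 0 <= B.
Hypothesis m_bound : forall x i, 0 <= x -> `|m x 0 i| <= B.
Hypothesis m_init : m 0 = (1 - W 0) *: a.
Hypothesis W_step : forall x h, 0 <= x -> 0 <= h <= 1 ->
  `|W x - W (x + h) - lambda * h * (m x *m one) 0 0| <= C * h ^+ 2.
Hypothesis m_step : forall x h i, 0 <= x -> 0 <= h <= 1 ->
  `|m (x + h) 0 i - (m x *m expmx (h *: S)) 0 i - (W x - W (x + h)) * a 0 i|
    <= C * h ^+ 2.
Hypothesis W_cvg0 : W x @[x --> +oo%R] --> 0.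

Let a_ge0 i : 0 <= a 0 i. Proof. by case: a_prob. Qed.

Let a_le1 i : a 0 i <= 1.
Proof.
case: a_prob => a0 <-; rewrite (bigD1 i) //= lerDl sumr_ge0 //.
Qed.

Let expmx_norm_first_order (A : 'M[R]_n) x h i : 0 <= x -> 0 <= h <= 1 ->
  `|(m x *m expmx (h *: A)) 0 i - (m x *m (1%:M + h *: A)) 0 i| <=
  B * n%:R * expR (mxsum A) * h ^+ 2.
Proof.
move=> x0 h01.
have -> : (m x *m expmx (h *: A)) 0 i - (m x *m (1%:M + h *: A)) 0 i =
    (m x *m (expmx (h *: A) - (1%:M + h *: A))) 0 i.
  by rewrite mulmxBr [RHS]mxE [X in _ = _ + X]mxE.
rewrite mxE (le_trans (ler_norm_sum _ _ _)) //.
apply: le_trans (_ : \sum_(j < n) B * (h ^+ 2 * expR (mxsum A)) <= _).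
  apply: ler_sum => j _; rewrite normrM ler_pM // ?m_bound //.
  have := expmx_first_order A j i h01; by rewrite [X in _ -> `|X| <= _]mxE [X in _ -> `|_ + X| <= _]mxE.
rewrite sumr_const card_ord -mulr_natl le_eqVlt; apply/orP; left; apply/eqP; ring.
Qed.

(** Jobs that find the workload in the window from [x] to [x + h] enter [m] in phase [a]; by
    [W_step] their mass is lambda h times the mass of [m x], and this is the rank-one part of [T].
    The four constants come from [m_step], [W_step] and the expansions of e^{hS} and e^{hT}. *)
Let m_stepT : exists2 C', 0 <= C' & forall x h i, 0 <= x -> 0 <= h <= 1 ->
  `|m (x + h) 0 i - (m x *m expmx (h *: T)) 0 i| <= C' * h ^+ 2.
Proof.
exists (C + C + B * n%:R * expR (mxsum S) + B * n%:R * expR (mxsum T)).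
  by rewrite !addr_ge0 // !mulr_ge0 ?expR_ge0.
move=> x h i x0 h01.
have E : (m x *m (1%:M + h *: T)) 0 i =
    (m x *m (1%:M + h *: S)) 0 i + lambda * h * (m x *m one) 0 0 * a 0 i.
  have -> : m x *m (1%:M + h *: T) = m x *m (1%:M + h *: S) +
      (lambda * h) *: (m x *m one *m a).
    by rewrite /T scalerDr addrA mulmxDr -!scalemxAr scalerA mulrC mulmxA.
  rewrite mxE; congr (_ + _); rewrite mxE -[RHS]mulrA; congr (_ * _).
  by rewrite mxE big_ord1.
have H1 := m_step i x0 h01.
have H2 := W_step x0 h01.
have H3 := expmx_norm_first_order S i x0 h01.
have H4 := expmx_norm_first_order T i x0 h01.
rewrite E in H4.
have H2' : `|(W x - W (x + h) - lambda * h * (m x *m one) 0 0) * a 0 i| <= C * h ^+ 2.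
  rewrite normrM; apply: le_trans H2; rewrite ler_piMr // ger0_norm //.
move: H1 H2' H3 H4; rewrite !ler_norml.
set x1 := m (x + h) 0 i; set x2 := (m x *m expmx (h *: S)) 0 i.
set x3 := (m x *m expmx (h *: T)) 0 i; set x4 := (m x *m (1%:M + h *: S)) 0 i.
set x5 := (m x *m one) 0 0.
set y1 := (W x - W (x + h)) * a 0 i; set y2 := lambda * h * x5 * a 0 i.
have -> : (W x - W (x + h) - lambda * h * x5) * a 0 i = y1 - y2.
  by rewrite /y1 /y2; ring.
set z1 := C * h ^+ 2; set z2 := B * _ * _ * _; set z3 := B * _ * _ * _.
have -> : (C + C + B * n%:R * expR (mxsum S) + B * n%:R * expR (mxsum T)) * h ^+ 2 =
  z1 + z1 + z2 + z3 by rewrite /z1 /z2 /z3; ring.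
move=> /andP[? ?] /andP[? ?] /andP[? ?] /andP[? ?]; apply/andP; split; lra.
Qed.

(** Discrete version of the argument of [expmx_ode]: m(y) e^{(x-y)T} v has quadratic increments in
    y, hence equal values at 0 and x. *)
Let m_solution x (v : 'cV[R]_n) : 0 <= x ->
  (m x *m v) 0 0 = (1 - W 0) * (a *m expmx (x *: T) *m v) 0 0.
Proof.
move=> x0; have [C' C'0 mT] := m_stepT.
pose D y := (m y *m expmx ((x - y) *: T) *m v) 0 0.
have -> : (m x *m v) 0 0 = D x by rewrite /D subrr scale0r expmx0 mulmx1.
have -> : (1 - W 0) * (a *m expmx (x *: T) *m v) 0 0 = D 0.
  by rewrite /D subr0 m_init -!scalemxAl [RHS]mxE.
apply: (@quadratic_increments_cst _ D x
  (C' * ((n * n)%:R * expR (x * mxsum T)) * mxsum v)) => //.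
move=> y h y0 h01 yhx; have /andP[h0 h1] := h01; rewrite /D.
have -> : x - y = h + (x - (y + h)) by ring.
rewrite [expmx ((h + _) *: T)]expmxD mulmxA.
set E := expmx ((x - (y + h)) *: T).
have -> : (m (y + h) *m E *m v) 0 0 - (m y *m expmx (h *: T) *m E *m v) 0 0 =
   ((m (y + h) - m y *m expmx (h *: T)) *m E *m v) 0 0.
  by rewrite !mulmxBl [RHS]mxE [X in _ = _ + X]mxE.
have Eb : mxsum E <= (n * n)%:R * expR (x * mxsum T).
  by apply: expmx_mxsum_le; rewrite subr_ge0 yhx /= lerBlDr lerDl addr_ge0.
have Eb0 : 0 <= (n * n)%:R * expR (x * mxsum T) by rewrite mulr_ge0 ?expR_ge0.
set b := _ * expR _ in Eb Eb0 *.
have -> : C' * b * mxsum v * h ^+ 2 = (C' * h ^+ 2 * b) * mxsum v by ring.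
apply: mulmx_norm_le => [|k].
  by rewrite !mulr_ge0 // exprn_ge0.
apply: le_trans (_ : C' * h ^+ 2 * mxsum E <= _); last first.
  by rewrite ler_wpM2l // mulr_ge0 // exprn_ge0.
apply: mulmx_norm_le => [|l]; first by rewrite mulr_ge0 // exprn_ge0.
by have := mT y h l y0 h01; rewrite [X in _ -> `|X| <= _]mxE [X in _ -> `|_ + X| <= _]mxE.
Qed.

Lemma workload_tail_solution x : 0 <= x ->
  W x = lambda * (a *m expmx (x *: T) *m u) 0 0.
Proof.
have [l0 l1] := andP lambda01.
have l1' : 0 < 1 - lambda by rewrite subr_gt0.
have l1n : 1 - lambda != 0 by rewrite gt_eqF.
(* Chosen so that T w = -1: to first order lambda m w then changes over a step by -lambda h m 1,
   exactly as [W] does, and the difference [F] is constant. *)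
pose w := (1 - lambda)^-1 *: u.
have Tw : T *m w = - one.
  rewrite -scalemxAr rank_one_update_mul_mean // scalerA mulrN mulVf // scaleN1r //.
pose F y := W y - lambda * (m y *m w) 0 0.
have [C' C'0 mT] := m_stepT.
have Fcst y : 0 <= y -> F y = F 0.
  move=> y0; apply: (@quadratic_increments_cst _ F y
    (C + lambda * (C' * mxsum w + B * n%:R * expR (mxsum T) * mxsum w))) => //.
  move=> z h z0 h01 _; rewrite /F; have /andP[h0 h1] := h01.
  have H1 := W_step z0 h01.
  have H2 : `|((m (z + h) - m z *m expmx (h *: T)) *m w) 0 0| <= C' * h ^+ 2 * mxsum w.
    apply: mulmx_norm_le => [|k]; first by rewrite mulr_ge0 ?exprn_ge0.
    by have := mT z h k z0 h01; rewrite [X in _ -> `|X| <= _]mxE [X in _ -> `|_ + X| <= _]mxE.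
  have H3 : `|((m z *m expmx (h *: T) - m z *m (1%:M + h *: T)) *m w) 0 0| <=
      B * n%:R * expR (mxsum T) * h ^+ 2 * mxsum w.
    apply: mulmx_norm_le => [|k].
      by rewrite !mulr_ge0 ?expR_ge0 ?exprn_ge0.
    have := expmx_norm_first_order T k z0 h01.
    by rewrite [X in _ -> `|X| <= _]mxE [X in _ -> `|_ + X| <= _]mxE.
  rewrite mulmxBl mxE [X in _ + X]mxE in H2.
  rewrite mulmxBl mxE [X in _ + X]mxE in H3.
  have E : (m z *m (1%:M + h *: T) *m w) 0 0 = (m z *m w) 0 0 - h * (m z *m one) 0 0.
    have -> : m z *m (1%:M + h *: T) *m w = m z *m w - h *: (m z *m one).
      by rewrite -mulmxA mulmxDl mul1mx mulmxDr -(scalemxAl h) Tw scalerN mulmxN (scalemxAr h).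
    by rewrite mxE [X in _ + X]mxE [X in _ - X]mxE.
  rewrite E in H3; move: H1 H2 H3.
  set x1 := (m z *m one) 0 0; set x2 := (m (z + h) *m w) 0 0.
  set x3 := (m z *m expmx (h *: T) *m w) 0 0; set x4 := (m z *m w) 0 0.
  set B' := B * n%:R * expR (mxsum T).
  have -> : W (z + h) - lambda * x2 - (W z - lambda * x4) =
    - (W z - W (z + h) - lambda * h * x1) - lambda * (x2 - x3)
      - lambda * (x3 - (x4 - h * x1)) by ring.
  move=> H1 H2 H3.
  apply: le_trans (ler_normB _ _) _; apply: le_trans (lerD (ler_normB _ _) (lexx _)) _.
  rewrite normrN !normrM gtr0_norm //.
  have -> : (C + lambda * (C' * mxsum w + B' * mxsum w)) * h ^+ 2 =
    C * h ^+ 2 + lambda * (C' * h ^+ 2 * mxsum w) +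
      lambda * (B' * h ^+ 2 * mxsum w) by ring.
  by apply: lerD; [apply: lerD => //|]; rewrite ler_wpM2l // ltW.
have u0 i : 0 < u i 0 by exact: subgenerator_inv_gt0.
have w0 i : 0 < w i 0 by rewrite mxE mulr_gt0 // invr_gt0.
have [th0 _] := workload_decay_exponent S_subgen S_unit a_prob lambda01 mean1
  (lexx (mxsum S)).
have T0 := rank_one_update_shift_ge0 S_subgen a_prob lambda01 (lexx (mxsum S)).
have an0 := probability_vector_neq0 a_prob.
have [|Cw Cw0 wC] := @decay_upper_bound _ _ T (mxsum S) a T0 a_ge0 an0 w w0
  (decay_exponent T (mxsum S) a / 2).
  rewrite -/T -/one in th0 *; lra.
set th := decay_exponent _ _ _ in th0 wC.
have wcv : (m y *m w) 0 0 @[y --> +oo%R] --> 0.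
  have gcv : (a *m expmx (y *: T) *m w) 0 0 @[y --> +oo%R] --> 0.
    apply: (@exp_bounded_cvg0 _ _ Cw (th / 2)); first by rewrite divr_gt0.
    move=> t t0; rewrite wC // andbT ltW //.
    exact: (phase_tail_gt0 T0 a_ge0 an0 w0).
  have : (1 - W 0) * (a *m expmx (y *: T) *m w) 0 0 @[y --> +oo%R] --> (1 - W 0) * 0.
    by apply: cvgM gcv; exact: cvg_cst.
  rewrite mulr0; apply: cvg_trans; apply: near_eq_cvg; near=> y.
  rewrite m_solution //; near: y; apply: nbhs_pinfty_ge; rewrite num_real //.
(* Both parts of [F] vanish at infinity: [W] as a tail, m w because the decay exponent of [T] is
   positive. *)
have F0 : F 0 = 0.
  have h1 : F y @[y --> +oo%R] --> (0 - lambda * 0).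
    by apply: cvgB => //; apply: cvgM wcv; exact: cvg_cst.
  have h2 : F y @[y --> +oo%R] --> F 0.
    apply: cvg_near_cst; near=> y; apply: Fcst.
    by near: y; apply: nbhs_pinfty_ge; rewrite num_real.
  by rewrite -(cvg_lim _ h2) // (cvg_lim _ h1) // mulr0 subr0.
have WE y : 0 <= y -> W y = lambda * (1 - W 0) * (a *m expmx (y *: T) *m w) 0 0.
  move=> y0; have := Fcst y y0; rewrite F0 /F => /eqP; rewrite subr_eq0 => /eqP ->.
  by rewrite m_solution // mulrA.
(* At level 0, a w = (1 - lambda)^-1 turns the formula into W(0) (1 - lambda) = lambda (1 -
   W(0)). *)
have W0 : W 0 = lambda.
  have := WE 0 (lexx _); rewrite scale0r expmx0 mulmx1 -scalemxAr mxE mean1 mulr1.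
  move=> H; have : W 0 * (1 - lambda) = lambda * (1 - W 0).
    by rewrite {1}H divfK.
  by lra.
move=> x0; rewrite WE // W0.
have -> : (a *m expmx (x *: T) *m w) 0 0 =
    (1 - lambda)^-1 * (a *m expmx (x *: T) *m u) 0 0.
  by rewrite /w -(scalemxAr (1 - lambda)^-1) mxE.
by rewrite mulrA mulfK.
Unshelve. all: by end_near. Qed.

End WorkloadTail.

(** * One short time step of the queue *)

Section WorkloadPath.
Variables (R : realType) (w0 : R) (tau x : nat -> R).
Hypothesis tau_ge0 : forall k, 0 <= tau k.

Lemma arrival_epoch_homo : {homo arrival_epoch tau : m n / (m <= n)%N >-> m <= n}.
Proof.
apply: homo_leq => [//|? ? ?|k]; first exact: le_trans.
by rewrite /arrival_epoch big_nat_recr //= lerDl.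
Qed.

Lemma arrival_countE t n :
  arrival_epoch tau n <= t < arrival_epoch tau n.+1 -> arrival_count tau t = n.
Proof.
move=> n12; apply: xget_unique => // m m12.
have key k l : arrival_epoch tau k <= t < arrival_epoch tau k.+1 ->
    arrival_epoch tau l <= t < arrival_epoch tau l.+1 -> (l <= k)%N.
  move=> /andP[_ k2] /andP[l1 _]; rewrite leqNgt; apply/negP => kl.
  have := lt_le_trans k2 (le_trans (arrival_epoch_homo kl) l1).
  by rewrite ltxx.
by apply/eqP; rewrite eqn_leq (key n m) // (key m n).
Qed.

Lemma workload_no_arrival t : 0 <= t < tau 0%N ->
  workload w0 tau x t = Num.max 0 (w0 - t).
Proof.
move=> t0; rewrite /workload (@arrival_countE t 0) /=; last first.
  by rewrite /arrival_epoch big_nil big_nat1.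
by rewrite /arrival_epoch big_nil subr0.
Qed.

Lemma workload_one_arrival t : tau 0%N <= t < tau 0%N + tau 1%N ->
  workload w0 tau x t =
  Num.max 0 (Num.max 0 (w0 - tau 0%N) + x 0%N - (t - tau 0%N)).
Proof.
move=> t0; rewrite /workload (@arrival_countE t 1) /=; last first.
  by rewrite /arrival_epoch big_nat1 big_nat_recr //= big_nat1.
by rewrite /arrival_epoch big_nat1.
Qed.

End WorkloadPath.

(** * Measurability of the workload at a fixed time *)

Section WorkloadMeasurability.
Context d (Omega : measurableType d) (R : realType).
Variables (w0 : Omega -> R) (tau x : nat -> Omega -> R).
Hypothesis tau_ge0 : forall k w, 0 <= tau k w.
Hypothesis mw0 : measurable_fun setT w0.
Hypothesis mtau : forall k, measurable_fun setT (tau k).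
Hypothesis mx : forall k, measurable_fun setT (x k).

Let mepoch n : measurable_fun setT (fun w => arrival_epoch (tau ^~ w) n).
Proof. by rewrite /arrival_epoch; apply: measurable_sum. Qed.

Let mafter n :
  measurable_fun setT (fun w => workload_after (w0 w) (tau ^~ w) (x ^~ w) n).
Proof.
elim: n => [//|n IH] /=; apply: measurable_funD => //.
by apply: measurable_maxr => //; apply: measurable_funB.
Qed.

Lemma measurable_workload_gt t y :
  measurable [set w | y < workload (w0 w) (tau ^~ w) (x ^~ w) t].
Proof.
pose N n := [set w | arrival_epoch (tau ^~ w) n <= t < arrival_epoch (tau ^~ w) n.+1].
pose V n := [set w | y < Num.max 0
  (workload_after (w0 w) (tau ^~ w) (x ^~ w) n - (t - arrival_epoch (tau ^~ w) n))].
have mN n : measurable (N n).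
  have -> : N n = (fun w => arrival_epoch (tau ^~ w) n) @^-1` `]-oo, t] `&`
    (fun w => arrival_epoch (tau ^~ w) n.+1) @^-1` `]t, +oo[.
    apply/seteqP; split => w /=; rewrite !in_itv /= ?andbT.
      by move=> /andP.
    by move=> ?; apply/andP.
  by apply: measurableI; rewrite -[X in measurable X]setTI; exact: mepoch.
have mV n : measurable (V n).
  have -> : V n = (fun w => Num.max 0 (workload_after (w0 w) (tau ^~ w) (x ^~ w) n
     - (t - arrival_epoch (tau ^~ w) n))) @^-1` `]y, +oo[.
    by apply/seteqP; split => w /=; rewrite in_itv /= andbT.
  rewrite -[X in measurable X]setTI; apply: measurable_maxr => //.
  by apply: measurable_funB => //; apply: measurable_funB.
(* Where no [n] satisfies the arrival condition, [arrival_count] takes its default value 0, hence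
   the extra piece inside [V 0]. *)
have -> : [set w | y < workload (w0 w) (tau ^~ w) (x ^~ w) t] =
    (\bigcup_n (N n `&` V n)) `|` (~` (\bigcup_n N n) `&` V 0%N).
  apply/seteqP; split => w.
    rewrite /= => yw; have [[n Nn]|noN] := pselect (exists n, N n w).
      left; exists n => //; split => //; move: yw.
      by rewrite /workload (arrival_countE (fun k => tau_ge0 k w) Nn).
    right; split.
      by move=> [n _ Nn]; apply: noN; exists n.
    move: yw; rewrite /workload /V /=.
    suff -> : arrival_count (tau ^~ w) t = 0%N by [].
    by apply: xgetPN => n Nn; apply: noN; exists n.
  move=> [[n _ [Nn]]|[noN]]; rewrite /V /= /workload.
    by rewrite (arrival_countE (fun k => tau_ge0 k w) Nn).
  suff -> : arrival_count (tau ^~ w) t = 0%N by [].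
  by apply: xgetPN => n Nn; apply: noN; exists n.
apply: measurableU; first by apply: bigcup_measurable => n _; exact: measurableI.
apply: measurableI => //; apply: measurableC; exact: bigcup_measurable.
Qed.

End WorkloadMeasurability.

Section RealProbability.
Context d (Omega : measurableType d) (R : realType) (P : probability Omega R).
Implicit Types A B : set Omega.

Definition pr A : R := fine (P A).

Lemma prE A : measurable A -> P A = (pr A)%:E.
Proof. by move=> mA; rewrite /pr fineK // fin_num_measure. Qed.

Lemma pr_ge0 A : 0 <= pr A.
Proof. by rewrite /pr fine_ge0. Qed.

Lemma pr_le A B : measurable A -> measurable B -> A `<=` B -> pr A <= pr B.
Proof. by move=> mA mB AB; rewrite -lee_fin -!prE // le_measure ?inE. Qed.

Lemma pr_le1 A : measurable A -> pr A <= 1.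
Proof. by move=> mA; rewrite -lee_fin -prE // probability_le1. Qed.

Lemma prU A B : measurable A -> measurable B -> A `&` B = set0 ->
  pr (A `|` B) = pr A + pr B.
Proof.
move=> mA mB AB; apply: EFin_inj; rewrite EFinD -!prE //; last exact: measurableU.
by rewrite measureU.
Qed.

Lemma prU_le A B : measurable A -> measurable B -> pr (A `|` B) <= pr A + pr B.
Proof.
move=> mA mB; rewrite -lee_fin EFinD -!prE //; last exact: measurableU.
exact: measureU2.
Qed.

Lemma prC A : measurable A -> pr (~` A) = 1 - pr A.
Proof.
move=> mA; apply: EFin_inj; rewrite EFinB -!prE //; last exact: measurableC.
by rewrite probability_setC.
Qed.

End RealProbability.

(** * Stationarity over a short time interval *)

Section OneStep.
Context d (Omega : measurableType d) (R : realType) (P : probability Omega R).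
Variables (lambda : R) (Z : {RV P >-> R}) (tau J : nat -> {RV P >-> R}).
Hypothesis lambda_gt0 : 0 < lambda.
Hypothesis tau_ge0 : forall k w, 0 <= tau k w.
Hypothesis tau_law : forall k (A : set R), measurable A ->
  distribution P (tau k) A = exponential_prob lambda A.
Hypothesis Z_ge0 : forall w, 0 <= Z w.
Hypothesis J_ge0 : forall k w, 0 <= J k w.
Hypothesis Z_stationary : stationary_workload Z tau J.

Let mpre (f : {RV P >-> R}) (A : set R) : measurable A -> measurable (f @^-1` A).
Proof. by move=> mA; rewrite -[X in measurable X]setTI; exact: measurable_funP. Qed.

Let mgt (f : Omega -> R) x : measurable_fun setT f -> measurable [set w | x < f w].
Proof.
move=> mf; have -> : [set w | x < f w] = setT `&` f @^-1` `]x, +oo[.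
  by rewrite setTI; apply/seteqP; split => w /=; rewrite in_itv /= andbT.
exact: mf.
Qed.

Let mle (f : Omega -> R) x : measurable_fun setT f -> measurable [set w | f w <= x].
Proof.
move=> mf; have -> : [set w | f w <= x] = setT `&` f @^-1` `]-oo, x].
  by rewrite setTI; apply/seteqP; split => w /=; rewrite in_itv.
exact: mf.
Qed.

Definition tail (X : Omega -> R) (x : R) : R := pr P [set w | x < X w].

(** The level reached by a job that finds the stationary workload; its tail minus that of [Z] is P(Z
    <= x < Z + J). *)
Definition overshoot w := Z w + J 0%N w.

Hypothesis tau_indep_Z : forall h x,
  pr P ([set w | h < tau 0%N w] `&` [set w | x < Z w]) =
  pr P [set w | h < tau 0%N w] * tail Z x.
Hypothesis tau_indep_overshoot : forall h x,
  pr P ([set w | tau 0%N w <= h] `&` [set w | x < overshoot w]) =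
  pr P [set w | tau 0%N w <= h] * tail overshoot x.
Hypothesis tau_indep_tau : forall h,
  pr P ([set w | tau 0%N w <= h] `&` [set w | tau 1%N w <= h]) =
  pr P [set w | tau 0%N w <= h] * pr P [set w | tau 1%N w <= h].

Let m_overshoot : measurable_fun setT overshoot.
Proof. by apply: measurable_funD; exact: measurable_funP. Qed.

Lemma interarrival_cdf k h : 0 < h ->
  pr P [set w | tau k w <= h] = 1 - expR (- lambda * h).
Proof.
move=> h0; apply: EFin_inj; rewrite -prE; last exact: mle.
rewrite EFinB -exponential_prob_itv0c // -(tau_law k) //.
rewrite /distribution /pushforward; congr (P _).
by apply/seteqP; split => w /=; rewrite in_itv /= tau_ge0.
Qed.

Lemma interarrival_ccdf k h : 0 < h ->
  pr P [set w | h < tau k w] = expR (- lambda * h).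
Proof.
move=> h0; have -> : [set w | h < tau k w] = ~` [set w | tau k w <= h].
  by apply/seteqP; split => w /=; rewrite ltNge => /negP.
by rewrite prC ?interarrival_cdf //; [ring|exact: mle].
Qed.

Lemma stationary_tail t x : 0 <= t ->
  tail Z x = pr P [set w | x < workload (Z w) (tau ^~ w) (J ^~ w) t].
Proof.
move=> t0; rewrite /tail /pr; congr fine.
have := Z_stationary t0 (measurable_itv `]x, +oo[); rewrite /distribution /pushforward.
have -> : [set w | `]x, +oo[%classic (workload (Z w) (tau ^~ w) (J ^~ w) t)] =
   [set w | x < workload (Z w) (tau ^~ w) (J ^~ w) t].
  by apply/seteqP; split => w /=; rewrite in_itv /= andbT.
move=> ->; congr (P _).
by apply/seteqP; split => w /=; rewrite in_itv /= andbT.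
Qed.

Let mV h x : measurable [set w | x < workload (Z w) (tau ^~ w) (J ^~ w) h].
Proof. by apply: measurable_workload_gt => //. Qed.

Let no_arrival_event x h := [set w | h < tau 0%N w] `&` [set w | x + h < Z w].
Let arrival_event x h := [set w | tau 0%N w <= h] `&` [set w | x < overshoot w].
Let two_arrivals h := [set w | tau 0%N w <= h] `&` [set w | tau 1%N w <= h].

Let mno x h : measurable (no_arrival_event x h).
Proof. by apply: measurableI; apply: mgt => //; exact: measurable_funP. Qed.

Let marr x h : measurable (arrival_event x h).
Proof. by apply: measurableI; [apply: mle; exact: measurable_funP|exact: mgt]. Qed.

Let mtwo h : measurable (two_arrivals h).
Proof. by apply: measurableI; apply: mle; exact: measurable_funP. Qed.

Let pr_no x h : 0 < h ->
  pr P (no_arrival_event x h) = expR (- lambda * h) * tail Z (x + h).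
Proof. by move=> h0; rewrite tau_indep_Z interarrival_ccdf. Qed.

Let pr_arr x h : 0 < h ->
  pr P (arrival_event x h) = (1 - expR (- lambda * h)) * tail overshoot x.
Proof. by move=> h0; rewrite tau_indep_overshoot interarrival_cdf. Qed.

Let pr_two h : 0 < h -> pr P (two_arrivals h) = (1 - expR (- lambda * h)) ^+ 2.
Proof. by move=> h0; rewrite tau_indep_tau !interarrival_cdf. Qed.

(** If nothing arrives by time [h], the workload exceeds [x] exactly when [Z] exceeds [x + h]. After
    a single arrival it is at most Z + J. With more arrivals both interarrival times are at most
    [h], which costs (1 - q)^2. *)
Lemma tail_upper x h : 0 <= x -> 0 < h ->
  let q := expR (- lambda * h) in
  tail Z x <= q * tail Z (x + h) + (1 - q) * tail overshoot x + (1 - q) ^+ 2.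
Proof.
move=> x0 h0 /=; rewrite (stationary_tail x (ltW h0)).
rewrite -pr_no // -pr_arr // -pr_two //.
apply: le_trans (_ : pr P (no_arrival_event x h `|` arrival_event x h `|` two_arrivals h) <= _); last first.
  apply: le_trans (prU_le _ _ _) _ => //; first exact: measurableU.
  by rewrite lerD2r prU_le.
apply: pr_le => //; first by apply: measurableU => //; exact: measurableU.
move=> w /= xV; have [t0h|t0h] := ltP h (tau 0%N w).
  left; left; split => //=; move: xV.
  rewrite workload_no_arrival //; last by rewrite (ltW h0).
  by rewrite lt_max ltNge x0 /= ltrBrDr.
have [t1h|t1h] := leP (tau 1%N w) h; first by right; split.
left; right; split => //=; move: xV.
rewrite workload_one_arrival //; last first.
  by rewrite t0h /= (lt_le_trans t1h) // lerDr.
rewrite lt_max ltNge x0 /= => H; apply: (lt_le_trans H).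
rewrite /overshoot; have := tau_ge0 0%N w; have := Z_ge0 w.
by case: (leP 0 (Z w - tau 0%N w)) => ? ? ?; lra.
Qed.

(** After a single arrival the workload at time [h] is at least Z + J - h, so the threshold for the
    overshoot is raised to [x + h]. *)
Lemma tail_lower x h : 0 <= x -> 0 < h ->
  let q := expR (- lambda * h) in
  q * tail Z (x + h) + (1 - q) * tail overshoot (x + h) <= tail Z x + (1 - q) ^+ 2.
Proof.
move=> x0 h0 /=; rewrite (stationary_tail x (ltW h0)).
rewrite -pr_no // -pr_arr // -pr_two //.
rewrite -(@prU _ _ _ P (no_arrival_event x h) (arrival_event (x + h) h)) //; last first.
  rewrite -subset0 => w [[t0 _] [t1 _]].
  by have := lt_le_trans t0 t1; rewrite ltxx.
apply: le_trans (prU_le P (mV h x) (mtwo h)).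
apply: pr_le => //; [exact: measurableU|exact: measurableU|].
move=> w [[/= t0h Zx]|[/= t0h Zx]].
  left; rewrite /= workload_no_arrival //; last by rewrite (ltW h0).
  by rewrite lt_max ltrBrDr Zx orbT.
have [t1h|t1h] := leP (tau 1%N w) h; first by right; split.
left; rewrite /= workload_one_arrival //; last first.
  by rewrite t0h /= (lt_le_trans t1h) // lerDr.
rewrite lt_max; apply/orP; right; move: Zx; rewrite /overshoot.
by case: (leP 0 (Z w - tau 0%N w)) => ? ?; lra.
Qed.

Lemma tail_ge0 X x : 0 <= tail X x.
Proof. exact: pr_ge0. Qed.

Lemma tail_le1 X x : measurable_fun setT X -> tail X x <= 1.
Proof. by move=> mX; apply: pr_le1; exact: mgt. Qed.

Lemma tail_le X x y : measurable_fun setT X -> x <= y -> tail X y <= tail X x.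
Proof.
move=> mX xy; apply: pr_le; [exact: mgt|exact: mgt|].
by move=> w /= /(le_lt_trans xy).
Qed.

(** The upper bound leaves at most (1 - q) + (1 - q)^2, and 1 - q <= lambda h. In particular [Z] has
    no atom in the open half-line. *)
Lemma tail_Z_lip x h : 0 <= x -> 0 < h -> tail Z x - tail Z (x + h) <= 2 * lambda * h.
Proof.
move=> x0 h0; have := tail_upper x0 h0 => /=.
have q1 : 1 - lambda * h <= expR (- lambda * h).
  by rewrite (le_trans _ (expR_ge1Dx _)) // mulNr.
have q2 : expR (- lambda * h) <= 1.
  by rewrite -expR0 ler_expR mulNr oppr_le0 mulr_ge0 // ltW.
set q := expR _ in q1 q2 *; set a := tail Z (x + h); set b := tail overshoot x.
have b1 : b <= 1 by exact: tail_le1.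
have a0 : 0 <= a by exact: tail_ge0.
have q0 : 0 <= 1 - q by rewrite subr_ge0.
have H1 : (1 - q) * b <= 1 - q by rewrite ler_piMr.
have H2 : 0 <= (1 - q) * a by rewrite mulr_ge0.
have H3 : (1 - q) ^+ 2 <= 1 - q.
  by rewrite expr2 ler_piMr // lerBlDr lerDl expR_ge0.
lra.
Qed.

Variable c : R.
Hypothesis c_ge0 : 0 <= c.
Hypothesis overshoot_lip : forall x h, 0 <= x -> 0 <= h ->
  tail overshoot x - tail overshoot (x + h) <= c * h.

Lemma tail_one_step x h : 0 <= x -> 0 <= h ->
  `|tail Z x - tail Z (x + h) - lambda * h * (tail overshoot x - tail Z x)|
    <= (4 * lambda ^+ 2 + lambda * c) * h ^+ 2.
Proof.
move=> x0; rewrite le_eqVlt => /orP[/eqP <-|h0].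
  by rewrite addr0 subrr mulr0 mul0r subrr normr0 expr0n mulr0.
have up := tail_upper x0 h0; have lo := tail_lower x0 h0; move: up lo => /=.
have q1 : 1 - lambda * h <= expR (- lambda * h).
  by rewrite (le_trans _ (expR_ge1Dx _)) // mulNr.
have q3 : expR (- lambda * h) <= 1.
  by rewrite -expR0 ler_expR mulNr oppr_le0 mulr_ge0 // ltW.
have lh0 : 0 < lambda * h by rewrite mulr_gt0.
(* With y = lambda h, e^{-y} (1 + y) <= 1 and (1 - y + y^2)(1 + y) = 1 + y^3 >= 1. *)
have q2 : expR (- lambda * h) <= 1 - lambda * h + (lambda * h) ^+ 2.
  have : expR (- lambda * h) * (1 + lambda * h) <= 1.
    apply: le_trans (_ : expR (- lambda * h) * expR (lambda * h) <= _).
      by rewrite ler_wpM2l ?expR_ge0 // expR_ge1Dx.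
    by rewrite -expRD mulNr addNr expR0.
  have := expR_ge0 (- lambda * h); move: (expR _) (lambda * h) lh0 => q y y0 q0 qy.
  have : (1 - y + y ^+ 2) * (1 + y) = 1 + y ^+ 3 by ring.
  have y3 : 0 <= y ^+ 3 by rewrite exprn_ge0 // ltW.
  move=> E; rewrite -(ler_pM2r (_ : 0 < 1 + y)); last by rewrite addr_gt0.
  by rewrite E; lra.
have := tail_Z_lip x0 h0.
set q := expR _ in q1 q2 q3 *; set a := tail Z (x + h); set b := tail overshoot x.
(* In units of (lambda h)^2, the 4 is 1 for linearizing 1 - q, 2 for replacing the tail of [Z] at
   [x + h] by that at [x], and 1 for two arrivals. The term with [c] comes from the raised overshoot
   threshold. *)
have -> : (4 * lambda ^+ 2 + lambda * c) * h ^+ 2 =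
  4 * (lambda * h) ^+ 2 + lambda * h * (c * h) by ring.
have ba : b - tail overshoot (x + h) <= c * h by apply: overshoot_lip => //; exact: ltW.
set b' := tail overshoot (x + h) in ba *.
have b1 : b <= 1 by exact: tail_le1.
have b0 : 0 <= b by exact: tail_ge0.
have b'1 : b' <= 1 by exact: tail_le1.
have b'0 : 0 <= b' by exact: tail_ge0.
have a0 : 0 <= a by exact: tail_ge0.
have a1 : a <= 1 by apply: tail_le1; exact: measurable_funP.
have wa : a <= tail Z x by apply: tail_le; [exact: measurable_funP|rewrite lerDl ltW].
set W := tail Z x in wa *.
rewrite -[2 * lambda * h]mulrA; set y := lambda * h in lh0 q1 q2 q3 *.
set z := c * h in ba *; have z0 : 0 <= z by rewrite mulr_ge0 // ltW.
move=> Wa up lo.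
have y2 : 0 <= y ^+ 2 by rewrite exprn_ge0 // ltW.
have D1 : `|(1 - q - y) * (b - a)| <= y ^+ 2.
  rewrite normrM -[leRHS]mulr1 ler_pM // ler_norml; apply/andP; split; lra.
have D2 : `|(1 - q - y) * (b' - a)| <= y ^+ 2.
  rewrite normrM -[leRHS]mulr1 ler_pM // ler_norml; apply/andP; split; lra.
have D3 : y * (W - a) <= 2 * y ^+ 2.
  have -> : 2 * y ^+ 2 = y * (2 * y) by ring.
  by rewrite ler_wpM2l // ltW.
have D3' : 0 <= y * (W - a) by rewrite mulr_ge0 ?subr_ge0 // ltW.
have D4 : (1 - q) ^+ 2 <= y ^+ 2.
  rewrite !expr2 ler_pM //; lra.
have D5 : y * (b - b') <= y * z by rewrite ler_wpM2l // ltW.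
have yz : 0 <= y * z by rewrite mulr_ge0 // ltW.
move: D1 D2; rewrite !ler_norml => /andP[D1 D1'] /andP[D2 D2'].
have E1 : W - a - y * (b - W) = (W - (q * a + (1 - q) * b + (1 - q) ^+ 2))
   + (1 - q - y) * (b - a) + y * (W - a) + (1 - q) ^+ 2 by ring.
have E2 : W - a - y * (b - W) = (W + (1 - q) ^+ 2 - (q * a + (1 - q) * b'))
   + (1 - q - y) * (b' - a) - y * (b - b') + y * (W - a) - (1 - q) ^+ 2 by ring.
apply/andP; split; [rewrite E2|rewrite E1]; lra.
Qed.

End OneStep.

(** * Stationary distribution *)

Section ProductLaw.
Context d (Omega : measurableType d) (R : realType) (P : probability Omega R).
Variables (X Y : {RV P >-> R}) (D : set Omega).
Hypothesis mD : measurable D.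
Hypothesis XY_indep : forall A B : set R, measurable A -> measurable B ->
  P (D `&` (X @^-1` A `&` Y @^-1` B)) =
  (P D * (distribution P X A * distribution P Y B))%E.

Local Open Scope ereal_scope.

(** On [D] the law of the pair agrees on rectangles with a product measure whose first factor is
    scaled by P(D); uniqueness of product measures extends this to all measurable sets. *)
Lemma indep_pair_law (C : set (R * R)) : measurable C ->
  P (D `&` [set w | C (X w, Y w)]) =
  P D * (distribution P X \x distribution P Y) C.
Proof.
move=> mC.
have mXY : measurable_fun setT (fun w => (X w, Y w)).
  by apply: measurable_fun_pair; exact: measurable_funP.
have p0 : (0 <= fine (P D))%R by rewrite fine_ge0.
have PD : (fine (P D))%:E = P D by rewrite fineK // fin_num_measure.
pose m1 : {finite_measure set R -> \bar R} := mscale (NngNum p0) (distribution P X).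
pose m' : {measure set (R * R) -> \bar R} :=
  @measure_function_pushforward__canonical__measure_function_Measure _ _ _ _ R (mrestr P mD) _ mXY.
have H : (m1 \x distribution P Y) C = m' C.
  apply: product_measure_unique => // A B mA mB.
  rewrite /m' /m1 /= /pushforward /mrestr /mscale /= PD -muleA -XY_indep //.
  by rewrite setIC.
rewrite -PD; transitivity (m' C).
  by rewrite /m' /= /pushforward /mrestr setIC.
rewrite -H /product_measure1 /m1 ge0_integral_mscale //.
exact: measurable_fun_xsection.
Qed.

End ProductLaw.

(** * Integrals of bounded functions against a law *)

Section BoundedIntegrals.
Context (R : realType) (mu : probability R R).
Implicit Types f g : R -> R.

Definition bounded_measurable f :=
  measurable_fun setT f /\ exists M, forall z, `|f z| <= M.

Lemma bounded_measurable_integrable f : bounded_measurable f ->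
  mu.-integrable setT (EFin \o f).
Proof.
move=> [mf [M fM]]; apply: measurable_bounded_integrable => //.
  by apply: (le_lt_trans (probability_le1 _ _)) => //; exact: ltry.
exists M; split; first exact: num_real.
by move=> M' MM' z _ /=; rewrite (le_trans (fM z)) // ltW.
Qed.

Lemma bounded_measurableD f g : bounded_measurable f -> bounded_measurable g ->
  bounded_measurable (fun z => f z + g z).
Proof.
move=> [mf [M fM]] [mg [N gN]]; split; first exact: measurable_funD.
by exists (M + N) => z; rewrite (le_trans (ler_normD _ _)) // lerD.
Qed.

Lemma bounded_measurableZ f k : bounded_measurable f ->
  bounded_measurable (fun z => k * f z).
Proof.
move=> [mf [M fM]]; split; first by apply: measurable_funM.
by exists (`|k| * M) => z; rewrite normrM ler_wpM2l.
Qed.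

Lemma bounded_measurable_sum n (f : 'I_n -> R -> R) :
  (forall i, bounded_measurable (f i)) ->
  bounded_measurable (fun z => \sum_i f i z).
Proof.
elim: n f => [|n IH] f bf.
  split; first by under eq_fun do rewrite big_ord0; exact: measurable_cst.
  by exists 0 => z; rewrite big_ord0 normr0.
under eq_fun do rewrite big_ord_recl.
by apply: bounded_measurableD => //; apply: IH.
Qed.

Lemma integral_boundedD f g : bounded_measurable f -> bounded_measurable g ->
  \int[mu]_z (f z + g z) = \int[mu]_z f z + \int[mu]_z g z.
Proof. by move=> bf bg; apply: RintegralD => //; exact: bounded_measurable_integrable. Qed.

Lemma integral_boundedZ f k : bounded_measurable f ->
  \int[mu]_z (k * f z) = k * \int[mu]_z f z.
Proof. by move=> bf; apply: RintegralZl => //; exact: bounded_measurable_integrable. Qed.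

Lemma integral_bounded_sum n (f : 'I_n -> R -> R) :
  (forall i, bounded_measurable (f i)) ->
  \int[mu]_z (\sum_i f i z) = \sum_i \int[mu]_z f i z.
Proof.
elim: n f => [|n IH] f bf.
  under eq_Rintegral do rewrite big_ord0.
  by rewrite big_ord0 Rintegral_cst // mul0r.
under eq_Rintegral do rewrite big_ord_recl.
rewrite integral_boundedD //; last exact: bounded_measurable_sum.
by rewrite big_ord_recl IH.
Qed.

Lemma integral_bounded_le f g : bounded_measurable f -> bounded_measurable g ->
  (forall z, f z <= g z) -> \int[mu]_z f z <= \int[mu]_z g z.
Proof.
by move=> bf bg fg; apply: le_Rintegral => //; exact: bounded_measurable_integrable.
Qed.

Lemma integral_bounded_norm_le f g : bounded_measurable f -> bounded_measurable g ->
  (forall z, `|f z| <= g z) -> `|\int[mu]_z f z| <= \int[mu]_z g z.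
Proof.
move=> bf bg fg; rewrite ler_norml; apply/andP; split; last first.
  by apply: integral_bounded_le => // z; exact: le_trans (ler_norm _) (fg z).
rewrite -[leLHS]mulN1r -integral_boundedZ //; apply: integral_bounded_le => //.
  exact: bounded_measurableZ.
by move=> z; have := fg z; rewrite ler_norml mulN1r => /andP[]; lra.
Qed.

Lemma integral_bounded_cst k : \int[mu]_z k = k.
Proof. have mu1 : fine (mu setT) = 1 by rewrite probability_setT.
rewrite Rintegral_cst //; transitivity (k * fine (mu setT)) => //.
by rewrite mu1 mulr1. Qed.

End BoundedIntegrals.

(** * The phase of a job as a function of attained service *)

Section PhaseProcess.
Variables (R : realType) (n : nat) (S : 'M[R]_n) (a : 'rV[R]_n).
Hypothesis S_subgen : subgenerator S.
Hypothesis a_prob : probability_vector a.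

(** Probability that the absorbing Markov chain with initial law [a] and subgenerator [S] is in
    phase [j] at time [t]. *)
Definition phase (t : R) (j : 'I_n) : R := (a *m expmx (t *: S)) 0 j.

Let a_ge0 : forall i j, 0 <= a i j.
Proof. by move=> i j; rewrite (ord1 i); case: a_prob. Qed.

Let M := S + (mxsum S)%:M.

Let tM_ge0 t : 0 <= t -> forall i j, 0 <= (t *: M) i j.
Proof.
by move=> t0 i j; rewrite mxE mulr_ge0 // subgenerator_shift_ge0.
Qed.

Lemma subgenerator_expmx_ge0 t : 0 <= t -> forall i j, 0 <= expmx (t *: S) i j.
Proof.
move=> t0 i j; rewrite (expmx_shift _ (mxsum S)) mxE mulr_ge0 ?expR_ge0 //.
by apply: expmx_ge0; exact: tM_ge0.
Qed.

Lemma phase_ge0 t j : 0 <= t -> 0 <= phase t j.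
Proof. by move=> t0; apply: mulmx_ge0 => // r s; exact: subgenerator_expmx_ge0. Qed.

Lemma phase_sum t : \sum_j phase t j = total_mass (a *m expmx (t *: S)).
Proof. by rewrite /total_mass mxE; apply: eq_bigr => j _; rewrite [X in _ = _ * X]mxE mulr1. Qed.

Lemma phaseD t h j : phase (t + h) j = \sum_k phase t k * expmx (h *: S) k j.
Proof. by rewrite /phase expmxD mulmxA mxE. Qed.

(** A job survives a further [h] at least by remaining in its phase, and the diagonal of e^{hS} is
    bounded below by e^{-ch} with c = [mxsum S]. *)
Lemma phase_sum_decr t h : 0 <= t -> 0 <= h ->
  (1 - mxsum S * h) * (\sum_j phase t j) <= \sum_j phase (t + h) j.
Proof.
move=> t0 h0; apply: le_trans (_ : expR (- mxsum S * h) * \sum_j phase t j <= _).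
  rewrite ler_wpM2r ?sumr_ge0 // => [j _|]; first exact: phase_ge0.
  by rewrite (le_trans _ (expR_ge1Dx _)) // mulNr.
rewrite mulr_sumr; apply: ler_sum => j _; rewrite phaseD (bigD1 j) //=.
rewrite -[leLHS]addr0 lerD //; last first.
  by rewrite sumr_ge0 // => k _; rewrite mulr_ge0 ?phase_ge0 ?subgenerator_expmx_ge0.
rewrite mulrC ler_wpM2l ?phase_ge0 // (expmx_shift _ (mxsum S)) mxE.
rewrite ler_peMr ?expR_ge0 //.
have := expmx_ge_term j j 0 (tM_ge0 h0).
by rewrite expr0 fact0 divr1 mxE eqxx.
Qed.

Lemma phase_near0 : exists2 C, 0 <= C &
  forall r j, 0 <= r <= 1 -> `|phase r j - a 0 j| <= C * r.
Proof.
exists (mxsum S + expR (mxsum S)); first by rewrite addr_ge0 ?mxsum_ge0 ?expR_ge0.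
move=> r j r01; have /andP[r0 r1] := r01.
have Eb k : `|(expmx (r *: S) - 1%:M) k j| <= (mxsum S + expR (mxsum S)) * r.
  have := expmx_first_order S k j r01.
  have -> : (1%:M + r *: S) k j = (1%:M : 'M[R]_n) k j + r * S k j.
    by rewrite mxE [X in _ + X]mxE.
  have -> : (expmx (r *: S) - 1%:M) k j = expmx (r *: S) k j - (1%:M : 'M[R]_n) k j.
    by rewrite mxE [X in _ + X]mxE.
  set e := expmx _ _ _; set u := (1%:M : 'M[R]_n) k j => H.
  have -> : e - u = (e - (u + r * S k j)) + r * S k j by ring.
  rewrite (le_trans (ler_normD _ _)) // addrC mulrDl lerD //.
    by rewrite normrM ger0_norm // mulrC ler_wpM2r // norm_le_mxsum.
  rewrite (le_trans H) // mulrC ler_wpM2l ?expR_ge0 // expr2 ler_piMl //.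
have -> : phase r j - a 0 j = (a *m (expmx (r *: S) - 1%:M)) 0 j.
  by rewrite mulmxBr mulmx1 [RHS]mxE [X in _ = _ + X]mxE.
rewrite mxE (le_trans (ler_norm_sum _ _ _)) //.
apply: le_trans (_ : \sum_k a 0 k * ((mxsum S + expR (mxsum S)) * r) <= _).
  by apply: ler_sum => k _; rewrite normrM ger0_norm // ler_wpM2l.
by rewrite -mulr_suml; case: a_prob => _ ->; rewrite mul1r.
Qed.

Lemma phase_continuous j : continuous (phase ^~ j).
Proof.
move=> t; rewrite /continuous_at.
have -> : phase ^~ j = (fun s => \sum_k a 0 k * expmx (s *: S) k j).
  by apply/funext => s; rewrite /phase mxE.
rewrite /phase mxE; apply: cvg_sumr => k.
apply: cvgM; first exact: cvg_cst.
have := is_derive_expmx S 1%:M k j t.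
under [fun s : R => _]eq_fun do rewrite mulmx1.
move=> [/derivable1_diffP/differentiable_continuous + _]; exact.
Qed.

End PhaseProcess.

(** * The increment estimates for the stationary queue *)

Section StationaryQueue.
Context d (Omega : measurableType d) (R : realType) (P : probability Omega R).
Variables (lambda : R) (Z : {RV P >-> R}) (tau J : nat -> {RV P >-> R}).
Variables (n : nat) (S : 'M[R]_n) (a : 'rV[R]_n).
Hypothesis lambda01 : 0 < lambda < 1.
Hypothesis tau_ge0 : forall k w, 0 <= tau k w.
Hypothesis tau_law : forall k (A : set R), measurable A ->
  distribution P (tau k) A = exponential_prob lambda A.
Hypothesis Z_ge0 : forall w, 0 <= Z w.
Hypothesis J_ge0 : forall k w, 0 <= J k w.
Hypothesis Z_stationary : stationary_workload Z tau J.
Hypothesis S_subgen : subgenerator S.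
Hypothesis S_unit : S \in unitmx.
Hypothesis a_prob : probability_vector a.
Hypothesis J_law : phase_type (J 0%N) a S.
Hypothesis tau_Z_J_indep : forall A B C : set R,
  measurable A -> measurable B -> measurable C ->
  P (tau 0%N @^-1` A `&` (Z @^-1` B `&` J 0%N @^-1` C)) =
  (P (tau 0%N @^-1` A) * (distribution P Z B * distribution P (J 0%N) C))%E.
Hypothesis tau_indep : forall A B : set R, measurable A -> measurable B ->
  P (tau 0%N @^-1` A `&` tau 1%N @^-1` B) =
  (P (tau 0%N @^-1` A) * P (tau 1%N @^-1` B))%E.

Let one : 'cV[R]_n := const_mx 1.
Let u := invmx (- S) *m one.
Hypothesis mean1 : (a *m u) 0 0 = 1.

Let lambda_gt0 : 0 < lambda. Proof. by case/andP: lambda01. Qed.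

Let mu := distribution P Z.
Let W := tail P Z.
Let G := tail P (overshoot Z J).

Let gtE (X : Omega -> R) x : [set w | x < X w] = X @^-1` `]x, +oo[.
Proof. by apply/seteqP; split => w /=; rewrite in_itv /= andbT. Qed.

Let leE (X : Omega -> R) x : [set w | X w <= x] = X @^-1` `]-oo, x].
Proof. by apply/seteqP; split => w /=; rewrite in_itv. Qed.

Let mpre (f : {RV P >-> R}) (A : set R) : measurable A -> measurable (f @^-1` A).
Proof. by move=> mA; rewrite -[X in measurable X]setTI; exact: measurable_funP. Qed.

Let pr_mul A B C : measurable A -> measurable B -> (P C = P A * P B)%E ->
  pr P C = pr P A * pr P B.
Proof. by move=> mA mB H; rewrite /pr H fineM ?fin_num_measure. Qed.

Let tau_indep_Z h x :
  pr P ([set w | h < tau 0%N w] `&` [set w | x < Z w]) =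
  pr P [set w | h < tau 0%N w] * tail P Z x.
Proof.
apply: pr_mul; rewrite ?gtE; [exact: mpre|exact: mpre|].
have := tau_Z_J_indep (measurable_itv `]h, +oo[) (measurable_itv `]x, +oo[) measurableT.
by rewrite preimage_setT setIT probability_setT mule1.
Qed.

Let tau_indep_tau h :
  pr P ([set w | tau 0%N w <= h] `&` [set w | tau 1%N w <= h]) =
  pr P [set w | tau 0%N w <= h] * pr P [set w | tau 1%N w <= h].
Proof.
apply: pr_mul; rewrite ?leE; [exact: mpre|exact: mpre|].
exact: tau_indep.
Qed.

Let above x : set (R * R) := [set zy | x < zy.1 + zy.2].

Let m_above x : measurable (above x).
Proof.
have -> : above x = setT `&` (fun zy : R * R => zy.1 + zy.2) @^-1` `]x, +oo[.
  by rewrite setTI; apply/seteqP; split => w /=; rewrite in_itv /= andbT.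
have mf : measurable_fun setT (fun zy : R * R => zy.1 + zy.2).
  by apply: measurable_funD; [exact: measurable_fst|exact: measurable_snd].
by apply: mf.
Qed.

Let pair_law (A : set R) (C : set (R * R)) : measurable A -> measurable C ->
  P (tau 0%N @^-1` A `&` [set w | C (Z w, J 0%N w)]) =
  (P (tau 0%N @^-1` A) * (distribution P Z \x distribution P (J 0%N)) C)%E.
Proof.
move=> mA mC; apply: indep_pair_law => //; first exact: mpre.
by move=> B D mB mD; exact: tau_Z_J_indep.
Qed.

Let pair_law1 (C : set (R * R)) : measurable C ->
  P [set w | C (Z w, J 0%N w)] = (distribution P Z \x distribution P (J 0%N))%E C.
Proof.
move=> mC; have := pair_law measurableT mC.
by rewrite preimage_setT setTI probability_setT mul1e.
Qed.

Let tau_indep_overshoot h x :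
  pr P ([set w | tau 0%N w <= h] `&` [set w | x < overshoot Z J w]) =
  pr P [set w | tau 0%N w <= h] * tail P (overshoot Z J) x.
Proof.
have mf : measurable_fun setT (overshoot Z J).
  by apply: measurable_funD; exact: measurable_funP.
apply: pr_mul; first by rewrite leE; exact: mpre.
  by rewrite gtE -[X in measurable X]setTI; exact: mf.
have := pair_law (measurable_itv `]-oo, h]) (m_above x).
by rewrite -(pair_law1 (m_above x)) -leE.
Qed.

(** Probability, given Z = z, that the arriving job crosses level [x] while in phase [j]; a workload
    already above [x] contributes nothing. *)
Let phi x (j : 'I_n) (z : R) : R := if z <= x then phase S a (x - z) j else 0.

Let phase_total t : 0 <= t ->
  ccdf (J 0%N) t = (\sum_j phase S a t j)%:E.
Proof. by move=> t0; rewrite J_law // phase_sum. Qed.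

Let phase_sum_le1 t : 0 <= t -> \sum_j phase S a t j <= 1.
Proof.
by move=> t0; rewrite -lee_fin -phase_total // /ccdf probability_le1.
Qed.

Let phase_le1 t j : 0 <= t -> phase S a t j <= 1.
Proof.
move=> t0; apply: le_trans (phase_sum_le1 t0); rewrite (bigD1 j) //= lerDl.
by rewrite sumr_ge0 // => k _; exact: phase_ge0.
Qed.

Let phi_ge0 x j z : 0 <= phi x j z.
Proof. by rewrite /phi; case: ifPn => // zx; rewrite phase_ge0 // subr_ge0. Qed.

Let phi_le1 x j z : phi x j z <= 1.
Proof. by rewrite /phi; case: ifPn => // zx; rewrite phase_le1 // subr_ge0. Qed.

Let bm_phi x j : bounded_measurable (phi x j).
Proof.
split; last by exists 1 => z; rewrite ger0_norm ?phi_le1.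
have mphase : measurable_fun setT (phase S a ^~ j).
  by apply: continuous_measurable_fun; exact: phase_continuous.
have mB : measurable_fun setT (fun z : R => x - z) by exact: measurable_funB.
rewrite /phi; apply: measurable_fun_ifT; [exact: measurable_fun_ler| |by []].
exact: (measurableT_comp mphase mB).
Qed.

Let psi (x z : R) : R := (x < z)%R%:R.

Let bm_psi x : bounded_measurable (psi x).
Proof.
split; last by exists 1 => z; rewrite /psi; case: ltP => _; rewrite ?normr1 ?normr0.
rewrite (_ : psi x = fun z => if x < z then 1 else 0); last first.
  by apply/funext => z; rewrite /psi; case: ltP.
by apply: measurable_fun_ifT => //; apply: measurable_fun_ltr.
Qed.

Let W_integral x : W x = \int[mu]_z psi x z.
Proof.
rewrite /W /tail /pr /Rintegral gtE; congr fine.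
transitivity (\int[mu]_(z in setT) (\1_`]x, +oo[ z)%:E)%E.
  by rewrite integral_indic // setIT.
apply: eq_integral => z _; congr (_%:E); rewrite indicE /psi; congr (_%:R).
by rewrite mem_setE in_itv /= andbT.
Qed.

(** Integrands are functions on the whole line but need only agree where [Z] lives; pulling back to
    [Omega] makes nonnegativity of [Z] usable. *)
Let integral_Z_eq f g : bounded_measurable f -> bounded_measurable g ->
  (forall z, 0 <= z -> f z = g z) -> \int[mu]_z f z = \int[mu]_z g z.
Proof.
move=> bf bg fg.
have tr k : bounded_measurable k -> \int[mu]_z k z = \int[P]_w k (Z w).
  move=> [mk [M kM]]; rewrite /Rintegral /mu integral_distribution //.
    exact/measurable_EFinP.
  apply: (@measurable_bounded_integrable _ _ _ P (k \o Z)) => //.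
  - by apply: (le_lt_trans (probability_le1 _ _)) => //; exact: ltry.
  - by apply: measurableT_comp => //; exact: measurable_funP.
  - exists M; split; first exact: num_real.
    by move=> M' MM' z _ /=; rewrite (le_trans (kM _)) // ltW.
by rewrite !tr //; apply: eq_Rintegral => w _; rewrite fg.
Qed.

Let below x : set (R * R) := [set zy | zy.1 <= x /\ x < zy.1 + zy.2].

Let m_below x : measurable (below x).
Proof.
have -> : below x = (setT `&` fst @^-1` `]-oo, x]) `&` above x.
  by rewrite setTI; apply/seteqP; split => w /=; rewrite in_itv.
apply: measurableI => //; exact: measurable_fst.
Qed.

Let phi_total x z : \sum_j phi x j z =
  if z <= x then \sum_j phase S a (x - z) j else 0.
Proof. by rewrite /phi; case: ifP => // _; rewrite big1. Qed.

Let m x : 'rV[R]_n := \row_j \int[mu]_z phi x j z.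

Let m_total x : (m x *m one) 0 0 = \int[mu]_z \sum_j phi x j z.
Proof.
rewrite integral_bounded_sum //.
by rewrite mxE; apply: eq_bigr => j _; rewrite !mxE mulr1.
Qed.

(** Z + J exceeds [x] either because [Z] does or because the job crosses [x]. For the second event,
    the section of [below x] at z <= x is the event J > x - z, whose probability is the total phase
    mass. *)
Let overshoot_tail x : G x - W x = (m x *m one) 0 0.
Proof.
rewrite m_total; apply/eqP; rewrite subr_eq; apply/eqP.
have E : [set w | x < overshoot Z J w] =
    [set w | below x (Z w, J 0%N w)] `|` [set w | x < Z w].
  apply/seteqP; split => w /=.
    by move=> H; have [zx|zx] := leP (Z w) x; [left|right].
  move=> [[]//|zx]; apply: lt_le_trans zx _.
  by rewrite /overshoot lerDl.
have mb : measurable [set w | below x (Z w, J 0%N w)].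
  have mf : measurable_fun setT (fun w => (Z w, J 0%N w)).
    by apply: measurable_fun_pair; exact: measurable_funP.
  by rewrite -[X in measurable X]setTI; exact: mf.
rewrite /G /W /tail E prU //; last 2 first.
- by rewrite gtE; exact: mpre.
- by rewrite -subset0 => w [[zx _] xz]; have := le_lt_trans zx xz; rewrite ltxx.
congr (_ + _); rewrite /pr /Rintegral; congr fine; rewrite pair_law1 //.
apply: eq_integral => z _ /=; rewrite phi_total.
case: ifPn => [zx|xz].
  rewrite -phase_total ?subr_ge0 // /ccdf; congr (distribution P _ _).
  apply/seteqP; split => y; rewrite /xsection /= in_itv /= andbT ltrBlDl.
    by rewrite inE => -[].
  by move=> H; rewrite inE.
rewrite (_ : xsection _ _ = set0) ?measure0 //.
rewrite -subset0 => y; rewrite /xsection /= inE => -[/= zx _].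
by rewrite zx in xz.
Qed.

Let m_bound x i : 0 <= x -> `|m x 0 i| <= 1.
Proof.
move=> x0; rewrite mxE -(integral_bounded_cst mu 1).
apply: integral_bounded_norm_le => [||z]; first exact: bm_phi.
  by split => //; exists 1 => z; rewrite normr1.
by rewrite ger0_norm.
Qed.

(** For z >= 0 the integrand at level 0 is a_j on z = 0 and vanishes elsewhere, so only the atom of
    [Z] at 0 contributes. *)
Let m_init : m 0 = (1 - W 0) *: a.
Proof.
apply/matrixP => i j; rewrite (ord1 i) !mxE W_integral.
have bm1 : bounded_measurable (fun _ : R => 1 : R).
  by split => //; exists 1 => z; rewrite normr1.
have bp : bounded_measurable (fun z => 1 + -1 * psi 0 z).
  by apply: bounded_measurableD => //; exact: bounded_measurableZ.
rewrite -{1}(integral_bounded_cst mu 1) -mulN1r -integral_boundedZ //.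
rewrite -integral_boundedD //; last exact: bounded_measurableZ.
rewrite mulrC -integral_boundedZ //; apply: integral_Z_eq => //.
  exact: bounded_measurableZ.
move=> z z0; rewrite /phi /psi; have [zx|zx] := leP z 0.
  have -> : z = 0 by apply/eqP; rewrite eq_le zx.
  by rewrite subrr /phase scale0r expmx0 mulmx1 /=; ring.
by rewrite /=; ring.
Qed.

Let c := mxsum S.

Let Z_lip x h : 0 <= x -> 0 <= h -> W x - W (x + h) <= 2 * lambda * h.
Proof.
move=> x0; rewrite le_eqVlt => /orP[/eqP <-|h0].
  by rewrite addr0 subrr mulr0.
by apply: (tail_Z_lip (tau := tau) (J := J)).
Qed.

(** The tail of [Z] contributes 2 lambda h. For a fixed z <= x the survival probability drops by at
    most c h, and raising the level can only add values of z to the integral. *)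
Let overshoot_lip x h : 0 <= x -> 0 <= h -> G x - G (x + h) <= (2 * lambda + c) * h.
Proof.
move=> x0 h0.
have -> : G x - G (x + h) = (W x - W (x + h)) +
   ((m x *m one) 0 0 - (m (x + h) *m one) 0 0).
  (* The linear rearrangement is done on abstract reals, keeping [ring] away from the integrals. *)
  have key (g g' v v' p p' : R) : g - v = p -> g' - v' = p' ->
      g - g' = (v - v') + (p - p') by move=> <- <-; ring.
  exact: key (overshoot_tail x) (overshoot_tail (x + h)).
rewrite mulrDl; apply: lerD; first exact: Z_lip.
have subst (p p' q q' b : R) : p = q -> p' = q' -> q - q' <= b -> p - p' <= b.
  by move=> -> ->.
apply: (subst _ _ _ _ _ (m_total x) (m_total (x + h))).
have ch0 : 0 <= c * h by rewrite mulr_ge0 ?mxsum_ge0.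
have bs y : bounded_measurable (fun z => \sum_j phi y j z).
  by apply: bounded_measurable_sum => j; exact: bm_phi.
have bc : bounded_measurable (fun _ : R => c * h).
  by split => //; exists `|c * h|.
rewrite lerBlDr -(integral_bounded_cst mu (c * h)) -integral_boundedD //.
apply: integral_bounded_le => //; first exact: bounded_measurableD.
move=> z; rewrite !phi_total; case: ifPn => zx; last first.
  by rewrite addr_ge0 //; case: ifP => // zxh; rewrite sumr_ge0 // => j _; rewrite phase_ge0 // subr_ge0.
have zx0 : 0 <= x - z by rewrite subr_ge0.
rewrite (le_trans zx) ?lerDl //.
have := phase_sum_decr S_subgen a_prob zx0 h0; rewrite -/c.
have := phase_sum_le1 zx0; have -> : x + h - z = x - z + h by ring.
set s := \sum_j phase S a (x - z) j => s1.
have : c * h * s <= c * h by rewrite ler_piMr.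
lra.
Qed.

Let W_step x h : 0 <= x -> 0 <= h ->
  `|W x - W (x + h) - lambda * h * (m x *m one) 0 0|
    <= (4 * lambda ^+ 2 + lambda * (2 * lambda + c)) * h ^+ 2.
Proof.
move=> x0 h0; rewrite -overshoot_tail.
apply: (tail_one_step (tau := tau) (J := J)) => //.
by rewrite addr_ge0 ?mxsum_ge0 // mulr_ge0 // ltW.
Qed.

(** For z <= x the integrand vanishes by the semigroup law, and for z > x + h every term is zero. In
    between, the phase has age at most h and differs from [a] by at most C h, while the window has
    mass at most 2 lambda h. *)
Let m_step : exists2 C, 0 <= C & forall x h j, 0 <= x -> 0 <= h <= 1 ->
  `|m (x + h) 0 j - (m x *m expmx (h *: S)) 0 j - (W x - W (x + h)) * a 0 j|
    <= C * h ^+ 2.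
Proof.
have [C C0 near0] := phase_near0 S a_prob.
exists (C * (2 * lambda)); first by rewrite !mulr_ge0 // ltW.
move=> x h j x0 h01; have /andP[h0 h1] := h01.
pose E k := expmx (h *: S) k j.
pose D z := psi x z + -1 * psi (x + h) z.
have bD : bounded_measurable D.
  by apply: bounded_measurableD => //; exact: bounded_measurableZ.
have bE k : bounded_measurable (fun z => E k * phi x k z).
  by apply: bounded_measurableZ; exact: bm_phi.
have bS : bounded_measurable (fun z => -1 * \sum_k E k * phi x k z).
  by apply: bounded_measurableZ; exact: bounded_measurable_sum.
have bA : bounded_measurable (fun z => - a 0 j * D z) by exact: bounded_measurableZ.
have WD : W x - W (x + h) = \int[mu]_z D z.
  rewrite integral_boundedD //; last exact: bounded_measurableZ.
  by rewrite integral_boundedZ // mulN1r !W_integral.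
have mE : (m x *m expmx (h *: S)) 0 j = \int[mu]_z \sum_k E k * phi x k z.
  rewrite integral_bounded_sum // mxE; apply: eq_bigr => k _.
  by rewrite integral_boundedZ; [rewrite mxE mulrC|exact: bm_phi].
have -> : m (x + h) 0 j - (m x *m expmx (h *: S)) 0 j - (W x - W (x + h)) * a 0 j
   = \int[mu]_z (phi (x + h) j z + -1 * (\sum_k E k * phi x k z) + - a 0 j * D z).
  have bsum := bounded_measurable_sum bE.
  have I1 := integral_boundedD mu (bounded_measurableD (bm_phi (x + h) j) bS) bA.
  have I2 := integral_boundedD mu (bm_phi (x + h) j) bS.
  have I3 := integral_boundedZ mu (-1) bsum.
  have I4 := integral_boundedZ mu (- a 0 j) bD.
  have I5 : m (x + h) 0 j = \int[mu]_z phi (x + h) j z by rewrite mxE.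
  have key (mp me v k i1 i2 i3 i4 ip js jd : R) : i1 = i2 + i4 -> i2 = ip + i3 ->
      i3 = -1 * js -> i4 = - k * jd -> mp = ip -> me = js -> v = jd ->
      mp - me - v * k = i1 by move=> -> -> -> -> -> -> ->; ring.
  exact: key I1 I2 I3 I4 I5 mE WD.
apply: le_trans (_ : C * h * (W x - W (x + h)) <= _); last first.
  have -> : C * (2 * lambda) * h ^+ 2 = C * h * (2 * lambda * h) by ring.
  by rewrite ler_wpM2l ?mulr_ge0 // Z_lip.
rewrite WD -integral_boundedZ //.
apply: integral_bounded_norm_le.
- by apply: bounded_measurableD => //; apply: bounded_measurableD => //; exact: bm_phi.
- exact: bounded_measurableZ.
move=> z; rewrite /D /psi.
have [zx|xz] := leP z x.
  have zxh : z <= x + h by rewrite (le_trans zx) // lerDl.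
  rewrite [x + h < z]ltNge zxh /=.
  have -> : phi (x + h) j z = \sum_k E k * phi x k z.
    rewrite /phi zxh (_ : x + h - z = x - z + h); last by ring.
    by rewrite phaseD; apply: eq_bigr => k _; rewrite zx mulrC.
  rewrite mulr0 addr0 !mulr0 addr0 mulN1r subrr normr0 //.
have -> : \sum_k E k * phi x k z = 0.
  by rewrite big1 // => k _; rewrite /phi leNgt xz /= mulr0.
have [zxh|xhz] := leP z (x + h); last first.
  by rewrite /phi [z <= x + h]leNgt xhz /= !mulN1r !subrr !mulr0 addr0 normr0.
rewrite /phi zxh /= !mulr0 !addr0 !mulr1.
have r01 : 0 <= x + h - z <= 1 by apply/andP; split; lra.
apply: le_trans (near0 _ j r01) _; rewrite ler_wpM2l //; lra.
Qed.

Let W_cvg0 : W x @[x --> +oo] --> 0.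
Proof.
have -> : W = fine \o ccdf Z by apply/funext => x; rewrite /W /tail /pr gtE.
apply: fine_cvg; exact: cvg_ccdfy0.
Qed.

Lemma stationary_workload_tail t : 0 <= t ->
  ccdf Z t = (lambda * (a *m expmx (t *: (S + lambda *: (one *m a))) *m u) 0 0)%:E.
Proof.
move=> t0; have [C C0 mS] := m_step.
have lc : 0 <= 4 * lambda ^+ 2 + lambda * (2 * lambda + c).
  by rewrite addr_ge0 ?mulr_ge0 ?addr_ge0 ?mulr_ge0 ?exprn_ge0 ?mxsum_ge0 // ltW.
set C2 := 4 * _ + _ in lc.
have -> : ccdf Z t = (W t)%:E.
  rewrite /W /tail -prE; last by rewrite gtE; exact: mpre.
  by rewrite gtE.
congr (_%:E).
apply: (@workload_tail_solution R n S a lambda _ _ _ _ _ W m (C2 + C) 1) => //.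
- by rewrite addr_ge0.
- move=> x h x0 /andP[h0 _]; apply: le_trans (W_step x0 h0) _.
  by rewrite ler_wpM2r ?exprn_ge0 // lerDl.
- move=> x h i x0 h01; apply: le_trans (mS x h i x0 h01) _.
  by rewrite ler_wpM2r ?exprn_ge0 ?lerDr //; case/andP: h01.
Qed.

End StationaryQueue.

(** * Laws of the inputs and decay rates *)

Section PhaseTypeMean.
Context d (Omega : measurableType d) (R : realType) (P : probability Omega R).
Variables (X : {RV P >-> R}) (n : nat) (S : 'M[R]_n) (a : 'rV[R]_n).
Hypothesis S_subgen : subgenerator S.
Hypothesis S_unit : S \in unitmx.
Hypothesis a_prob : probability_vector a.
Hypothesis X_ge0 : forall w, 0 <= X w.
Hypothesis X_law : phase_type X a S.

Let one : 'cV[R]_n := const_mx 1.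
Let u := invmx (- S) *m one.

Let Su : S *m u = - one.
Proof.
have NS_unit : - S \in unitmx by rewrite unitmxE -scaleN1r detZ unitrM unitrX ?unitrN1.
by rewrite -[S]opprK mulNmx mulKVmx.
Qed.

Let f (t : R) : R := \sum_j phase S a t j.
Let F (t : R) : R := - (a *m expmx (t *: S) *m u) 0 0.

Let f_ccdf t : 0 <= t -> ccdf X t = (f t)%:E.
Proof. by move=> t0; rewrite X_law // /f phase_sum. Qed.

Let f_ge0 t : 0 <= t -> 0 <= f t.
Proof. by move=> t0; apply: sumr_ge0 => j _; exact: phase_ge0. Qed.

Let f_continuous : continuous f.
Proof. by move=> t; apply: cvg_sumr => j; exact: phase_continuous. Qed.

Let dF t : is_derive t (1 : R) F (f t).
Proof.
have d1 k : is_derive t (1 : R) (fun s : R => a 0 k * (expmx (s *: S) *m u) k 0)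
    (a 0 k * (expmx (t *: S) *m (S *m u)) k 0).
  have dk := is_deriveZ (a 0 k) (is_derive_expmx S u k 0 t).
  exact: (is_derive_eq dk).
have d2 := is_deriveN (is_derive_sum d1).
have -> : F = - (\sum_(k < n) (fun s : R => a 0 k * (expmx (s *: S) *m u) k 0)).
  apply/funext => s; rewrite /F fct_sumE -mulmxA mxE //.
apply: (is_derive_eq d2); rewrite -sumrN /f phase_sum /total_mass -mulmxA mxE.
by apply: eq_bigr => k _; rewrite Su mulmxN -mulrN mxE opprK.
Qed.

Let f_cvg0 : f t @[t --> +oo%R] --> 0.
Proof.
have h : fine (ccdf X t) @[t --> +oo%R] --> 0 by apply: fine_cvg; exact: cvg_ccdfy0.
apply: cvg_trans h; apply: near_eq_cvg; near=> t.
by rewrite f_ccdf //; near: t; apply: nbhs_pinfty_ge; rewrite num_real.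
Unshelve. all: by end_near. Qed.

(** Up to sign, [F] is at most [mxsum u] times the survival function, which tends to 0 as the tail
    of a real random variable. *)
Let F_cvg0 : F t @[t --> +oo%R] --> 0.
Proof.
rewrite -oppr0; apply: cvgN.
have u0 i : 0 < u i 0 by exact: subgenerator_inv_gt0.
have h : mxsum u * f t @[t --> +oo%R] --> 0.
  by rewrite -[X in _ --> X](mulr0 (mxsum u)); apply: cvgM f_cvg0; exact: cvg_cst.
apply: (squeeze_cvgr _ (cvg_cst 0) h); near=> t.
have t0 : 0 <= t by near: t; apply: nbhs_pinfty_ge; rewrite num_real.
rewrite mxE; apply/andP; split.
  by apply: sumr_ge0 => j _; rewrite mulr_ge0 ?(ltW (u0 _)) // phase_ge0.
rewrite mulr_sumr; apply: ler_sum => j _; rewrite [leRHS]mulrC.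
rewrite ler_wpM2l ?phase_ge0 // (le_trans (ler_norm _)) //; exact: norm_le_mxsum.
Unshelve. all: by end_near. Qed.

(** E X is the integral of the tail a e^{tS} 1. Since S u = -1, [F] is an antiderivative; it equals
    -a u at 0 and vanishes at infinity. *)
Lemma phase_type_mean : 'E_P[X]%E = ((a *m u) 0 0)%:E.
Proof.
rewrite ge0_expectation_ccdf //.
transitivity (\int[lebesgue_measure]_(t in `[0%R, +oo[) (f t)%:E)%E.
  apply: eq_integral => t; rewrite inE /= in_itv /= andbT => t0.
  exact: f_ccdf.
have Fder t : derivable F t 1 by have [] := dF t.
rewrite (@ge0_continuous_FTC2y R f F 0 0) //.
- by rewrite sub0e -EFinN /F opprK scale0r expmx0 mulmx1.
- by apply: continuous_subspaceT => t; exact: f_continuous.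
- apply: cvg_at_right_filter.
  exact/differentiable_continuous/derivable1_diffP.
- by move=> t _; rewrite derive1E; have [_ ->] := dF t.
Qed.

End PhaseTypeMean.

(** * Product formulas for two and four independent inputs *)

Section Independence.
Context d (Omega : measurableType d) (R : realType) (P : probability Omega R).

Lemma mutually_independent2 (I : Type) (E : I -> set (set Omega)) (i1 i2 : I)
    (A1 A2 : set Omega) :
  mutually_independent P E -> i1 <> i2 -> E i1 A1 -> E i2 A2 ->
  P (A1 `&` A2) = (P A1 * P A2)%E.
Proof.
move=> ind n12 E1 E2.
pose s (k : 'I_2) := if k == 0%N :> nat then i1 else i2.
pose A (k : 'I_2) := if k == 0%N :> nat then A1 else A2.
have /= := ind 2%N s _ A.
rewrite !big_ord_recl big_ord0 mule1 /A /=.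
have -> : \bigcap_(k : 'I_2) (if k == 0%N :> nat then A1 else A2) = A1 `&` A2.
  apply/seteqP; split => w.
    by move=> H; split; [exact: (H ord0)|exact: (H ord_max)].
  by move=> [w1 w2] [[|[|//]] ?].
apply.
  by move=> [[|[|//]] ?] [[|[|//]] ?] //=; rewrite /s /= => ?; try (by case: n12); exact: val_inj.
by move=> [[|[|//]] ?].
Qed.

Lemma mutually_independent4 (I : Type) (E : I -> set (set Omega)) (i1 i2 i3 i4 : I)
    (A1 A2 A3 A4 : set Omega) :
  mutually_independent P E ->
  i1 <> i2 -> i1 <> i3 -> i1 <> i4 -> i2 <> i3 -> i2 <> i4 -> i3 <> i4 ->
  E i1 A1 -> E i2 A2 -> E i3 A3 -> E i4 A4 ->
  P (A1 `&` (A2 `&` (A3 `&` A4))) = (P A1 * (P A2 * (P A3 * P A4)))%E.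
Proof.
move=> ind n12 n13 n14 n23 n24 n34 E1 E2 E3 E4.
pose s (k : 'I_4) := nth i1 [:: i1; i2; i3; i4] k.
pose A (k : 'I_4) := nth setT [:: A1; A2; A3; A4] k.
have := ind 4%N s _ A.
rewrite !big_ord_recl big_ord0 mule1 {2 3 4 5}/A /=.
have -> : \bigcap_k A k = A1 `&` (A2 `&` (A3 `&` A4)).
  apply/seteqP; split => w.
    move=> H; split; first exact: (H (@Ordinal 4 0 isT)).
    split; first exact: (H (@Ordinal 4 1 isT)).
    by split; [exact: (H (@Ordinal 4 2 isT))|exact: (H (@Ordinal 4 3 isT))].
  by move=> [w1 [w2 [w3 w4]]] [[|[|[|[|//]]]] ?].
apply.
  move=> [[|[|[|[|//]]]] ?] [[|[|[|[|//]]]] ?]; rewrite /s /= => e;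
    first [exact: val_inj | by exfalso; auto].
by move=> [[|[|[|[|//]]]] ?].
Qed.

Lemma preimage_event (T : measurableType d) d' (T' : measurableType d') (X : T -> T') (B : set T') :
  measurable B -> preimage_set_system setT X measurable (X @^-1` B).
Proof. by move=> mB; exists B => //; rewrite setTI. Qed.

End Independence.

(** * Law and independence of the mixed job size *)

Section QueueInputs.
Context d (Omega : measurableType d) (R : realType) (P : probability Omega R).
Variables (p : R) (n1 n2 : nat).
Variables (a1 : 'rV[R]_n1) (S1 : 'M[R]_n1) (a2 : 'rV[R]_n2) (S2 : 'M[R]_n2).
Variables (tau : nat -> {RV P >-> R}) (is_type1 : nat -> {RV P >-> bool}).
Variables (X1 X2 : nat -> {RV P >-> R}) (Z : {RV P >-> R}).
Hypothesis p01 : 0 < p < 1.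
Hypothesis type_law : forall k (A : set bool), measurable A ->
  distribution P (is_type1 k) A = bernoulli_prob p A.
Hypothesis X1_law : forall k, phase_type (X1 k) a1 S1.
Hypothesis X2_law : forall k, phase_type (X2 k) a2 S2.
Hypothesis indep : mutually_independent P (input_events Z tau is_type1 X1 X2).

Lemma measurable_job_size k : measurable_fun setT (job_size is_type1 X1 X2 k).
Proof. by apply: measurable_fun_ifT; exact: measurable_funP. Qed.

Definition job k : {RV P >-> R} := mfun_Sub (mem_set (measurable_job_size k)).

Let mpre d' (T : measurableType d') (f : {RV P >-> T}) (A : set T) :
  measurable A -> measurable (f @^-1` A).
Proof. by move=> mA; rewrite -[X in measurable X]setTI; exact: measurable_funP. Qed.

Let pr_type1 : pr P (is_type1 0%N @^-1` [set true]) = p.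
Proof.
have p01' : 0 <= p <= 1 by case/andP: p01 => *; rewrite !ltW.
apply: EFin_inj; rewrite -prE; last exact: mpre.
have mb : measurable ([set true] : set bool) by [].
have := type_law 0 mb; rewrite bernoulli_probE // !diracE.
rewrite mem_set // memNset //= mule1 mule0 adde0 => <- //.
Qed.

Let pr_type2 : pr P (is_type1 0%N @^-1` [set false]) = 1 - p.
Proof.
have p01' : 0 <= p <= 1 by case/andP: p01 => *; rewrite !ltW.
apply: EFin_inj; rewrite -prE; last exact: mpre.
have mb : measurable ([set false] : set bool) by [].
have := type_law 0 mb; rewrite bernoulli_probE // !diracE.
rewrite [true \in _]memNset // mem_set //= mule1 mule0 add0e => <- //.
Qed.

(** The job equals [X1] or [X2] according to its type, so the event splits into two disjoint
    intersections of four independent events. Taking [A] and [B] to be everything gives the law of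
    the job. *)
Let joint A B C : measurable A -> measurable B -> measurable C ->
  pr P (tau 0%N @^-1` A `&` (Z @^-1` B `&` job 0%N @^-1` C)) =
  pr P (tau 0%N @^-1` A) * (pr P (Z @^-1` B) *
    (p * pr P (X1 0%N @^-1` C) + (1 - p) * pr P (X2 0%N @^-1` C))).
Proof.
move=> mA mB mC.
pose E b (X : {RV P >-> R}) := tau 0%N @^-1` A `&`
  (Z @^-1` B `&` (is_type1 0%N @^-1` [set b] `&` X @^-1` C)).
have mE b X : measurable (E b X).
  by do 3 (apply: measurableI; first exact: mpre); exact: mpre.
have -> : tau 0%N @^-1` A `&` (Z @^-1` B `&` job 0%N @^-1` C) =
    E true (X1 0%N) `|` E false (X2 0%N).
  apply/seteqP; split => w; rewrite /E /= /job_size.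
    by case: ifP => tw [? []]; [left|right].
  by move=> [[? [? [-> ?]]]|[? [? [-> ?]]]].
rewrite prU //; last first.
  rewrite -subset0 => w [[_ [_ [t1 _]]] [_ [_ [t2 _]]]].
  by have := etrans (esym t1) t2.
have prod4 b X i : (i = Type1_time 0 /\ X = X1 0%N) \/ (i = Type2_time 0 /\ X = X2 0%N) ->
    pr P (E b X) = pr P (tau 0%N @^-1` A) * (pr P (Z @^-1` B) *
      (pr P (is_type1 0%N @^-1` [set b]) * pr P (X @^-1` C))).
  move=> iX; apply: EFin_inj; rewrite -prE //.
  rewrite (@mutually_independent4 _ _ _ P _ _ (Interarrival_time 0) Initial_workload
    (Job_type 0) i _ _ _ _ indep) //; try by case: iX => -[-> _].
  - by rewrite !EFinM -!prE //; exact: mpre.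
  - exact: preimage_event.
  - exact: preimage_event.
  - exact: preimage_event.
  - by case: iX => -[-> ->]; exact: preimage_event.
rewrite (@prod4 true (X1 0%N) (Type1_time 0)); last by left.
rewrite (@prod4 false (X2 0%N) (Type2_time 0)); last by right.
rewrite pr_type1 pr_type2; ring.
Qed.

Let pr_job C : measurable C -> pr P (job 0%N @^-1` C) =
  p * pr P (X1 0%N @^-1` C) + (1 - p) * pr P (X2 0%N @^-1` C).
Proof.
move=> mC; have := joint measurableT measurableT mC.
have pT : pr P setT = 1 by rewrite /pr probability_setT.
by rewrite !preimage_setT !setTI pT !mul1r.
Qed.

Lemma interarrival_workload_job_indep A B C :
  measurable A -> measurable B -> measurable C ->
  P (tau 0%N @^-1` A `&` (Z @^-1` B `&` job 0%N @^-1` C)) =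
  (P (tau 0%N @^-1` A) * (distribution P Z B * distribution P (job 0%N) C))%E.
Proof.
move=> mA mB mC; rewrite /distribution /pushforward prE; last first.
  by do 2 (apply: measurableI; first exact: mpre); exact: mpre.
by rewrite joint // -pr_job // !EFinM -!prE //; exact: mpre.
Qed.

Lemma interarrival_times_indep A B : measurable A -> measurable B ->
  P (tau 0%N @^-1` A `&` tau 1%N @^-1` B) =
  (P (tau 0%N @^-1` A) * P (tau 1%N @^-1` B))%E.
Proof.
move=> mA mB; apply: (@mutually_independent2 _ _ _ P _ _ (Interarrival_time 0)
  (Interarrival_time 1) _ _ indep) => //; exact: preimage_event.
Qed.

Lemma job_phase_type :
  phase_type (job 0%N) (mixture_vector p a1 a2) (mixture_matrix S1 S2).
Proof.
move=> t t0; rewrite mixture_total_mass /ccdf /distribution /pushforward prE; last exact: mpre.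
rewrite pr_job //; congr (_%:E).
have := X1_law 0 t0; have := X2_law 0 t0.
by rewrite /ccdf /distribution /pushforward /pr => -> ->.
Qed.

End QueueInputs.

(** * Decay rates of the tails and their comparison *)

Section DecayRates.
Context d (Omega : measurableType d) (R : realType) (P : probability Omega R).

Lemma has_decay_rateP (X : {RV P >-> R}) (f : R -> R) theta :
  (forall t, 0 <= t -> ccdf X t = (f t)%:E) -> (forall t, 0 <= t -> 0 < f t) ->
  t^-1 * ln (f t) @[t --> +oo%R] --> - theta -> has_decay_rate X theta.
Proof.
move=> Xf f0 fth; rewrite /has_decay_rate.
have E : \forall t \near +oo%R,
    ((t^-1)%:E * lne (ccdf X t))%E = (t^-1 * ln (f t))%:E.
  near=> t; have t0 : 0 <= t by near: t; apply: nbhs_pinfty_ge; rewrite num_real.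
  by rewrite Xf // lne_EFin ?f0 // EFinM.
apply: cvg_EFin; first by apply: filterS E => t ->.
apply: cvg_trans fth; apply: near_eq_cvg.
by apply: filterS E => t /= ->.
Unshelve. all: by end_near. Qed.

Lemma phase_type_decay_rate (X : {RV P >-> R}) n (S : 'M[R]_n) (a : 'rV[R]_n) :
  subgenerator S -> probability_vector a -> phase_type X a S ->
  has_decay_rate X (decay_exponent S (mxsum S) a).
Proof.
move=> Ss ap XS; have S0 := subgenerator_shift_ge0 Ss (lexx _).
have [a0 _] := ap; have an0 := probability_vector_neq0 ap.
have v0 i : 0 < (const_mx 1 : 'cV[R]_n) i 0 by rewrite mxE.
apply: (has_decay_rateP XS).
  by move=> t t0; exact: (phase_tail_gt0 S0 a0 an0 v0).
exact: (decay_exponent_cvg S0 a0 an0 v0).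
Qed.

End DecayRates.

(** [S] is block diagonal, so one row for the mixture provides a row for each type, with sources p
    a1 and (1 - p) a2. *)
Lemma mixture_resolvent (R : realType) n1 n2 (p mu : R) (a1 : 'rV[R]_n1)
    (a2 : 'rV[R]_n2) (S1 : 'M[R]_n1) (S2 : 'M[R]_n2) (eta : 'rV[R]_(n1 + n2)) :
  eta *m mixture_matrix S1 S2 + mixture_vector p a1 a2 = mu *: eta ->
  lsubmx eta *m S1 + p *: a1 = mu *: lsubmx eta /\
  rsubmx eta *m S2 + (1 - p) *: a2 = mu *: rsubmx eta.
Proof.
rewrite -{1 2}[eta]hsubmxK mul_row_block !mulmx0 addr0 add0r add_row_mx.
by rewrite scale_row_mx => /eq_row_mx.
Qed.

Lemma decay_exponent_gt_source (R : realType) n (q mu : R) (S : 'M[R]_n)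
    (a eta : 'rV[R]_n) : 0 < q -> subgenerator S -> probability_vector a ->
  (forall i, 0 <= eta 0 i) -> eta *m S + q *: a = - mu *: eta ->
  mu < decay_exponent S (mxsum S) a.
Proof.
move=> q0 Ss ap e0 eS; have S0 := subgenerator_shift_ge0 Ss (lexx _).
have [a0 _] := ap; have an0 := probability_vector_neq0 ap.
apply: (decay_exponent_gt S0 a0 an0 (eta := q^-1 *: eta)) => i.
  by rewrite mxE mulr_ge0 // invr_ge0 ltW.
have -> : (q^-1 *: eta *m S) 0 i + a 0 i = (q^-1 *: (eta *m S + q *: a)) 0 i.
  rewrite scalerDr scalerA mulVf ?gt_eqF // scale1r -scalemxAl.
  by rewrite [RHS]mxE.
by rewrite eS scalerA mulrC -scalerA [X in X <= _]mxE.
Qed.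

Theorem theorem3p1
  (R : realType) (d : measure_display) (Omega : measurableType d)
  (P : probability Omega R)
  (lambda p : R) (n1 n2 : nat)
  (alpha1 : 'rV[R]_n1) (S1 : 'M[R]_n1) (alpha2 : 'rV[R]_n2) (S2 : 'M[R]_n2)
  (tau : nat -> {RV P >-> R}) (is_type1 : nat -> {RV P >-> bool})
  (X1 X2 : nat -> {RV P >-> R}) (Z : {RV P >-> R})
  (lambda01 : 0 < lambda < 1) (p01 : 0 < p < 1)
  (alpha1_prob : probability_vector alpha1)
  (alpha2_prob : probability_vector alpha2)
  (S1_subgen : subgenerator S1) (S1_unit : S1 \in unitmx)
  (S2_subgen : subgenerator S2) (S2_unit : S2 \in unitmx)
  (tau_ge0 : forall k w, 0 <= tau k w)
  (X1_ge0 : forall k w, 0 <= X1 k w)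
  (X2_ge0 : forall k w, 0 <= X2 k w)
  (Z_ge0 : forall w, 0 <= Z w)
  (tau_law : forall k (A : set R), measurable A ->
     distribution P (tau k) A = exponential_prob lambda A)
  (type_law : forall k (A : set bool), measurable A ->
     distribution P (is_type1 k) A = bernoulli_prob p A)
  (X1_law : forall k, phase_type (X1 k) alpha1 S1)
  (X2_law : forall k, phase_type (X2 k) alpha2 S2)
  (indep : mutually_independent P (input_events Z tau is_type1 X1 X2))
  (mean_size : forall k, ('E_P[job_size is_type1 X1 X2 k] = 1)%E)
  (Z_stationary : stationary_workload Z tau (job_size is_type1 X1 X2)) :
  let alpha := mixture_vector p alpha1 alpha2 in
  let S := mixture_matrix S1 S2 in
  let beta := (1 - lambda) *: alpha in
  let T := S + lambda *: ((const_mx 1 : 'cV[R]_(n1 + n2)) *m alpha) in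
  (forall t : R, 0 <= t ->
     ccdf Z t =
       (lambda * total_mass (alpha *m expmx (t *: T) *m invmx (- S)))%:E /\
     lambda * total_mass (alpha *m expmx (t *: T) *m invmx (- S)) =
       lambda * total_mass (beta *m expmx (t *: T) *m invmx (- T))) /\
  (exists theta1 theta2 thetaZ : R,
     [/\ forall k, has_decay_rate (X1 k) theta1,
         forall k, has_decay_rate (X2 k) theta2,
         has_decay_rate Z thetaZ &
         0 < thetaZ < Num.min theta1 theta2]).
Proof.
move=> alpha S beta T.
have S_subgen : subgenerator S by exact: mixture_subgenerator.
have S_unit : S \in unitmx by exact: mixture_unitmx.
have alpha_prob : probability_vector alpha by exact: mixture_probability_vector.
pose J := job is_type1 X1 X2.
have J_ge0 k w : 0 <= J k w.
  have -> : J k w = if is_type1 k w then X1 k w else X2 k w by [].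
  by case: ifP.
have J_law : phase_type (J 0%N) alpha S.
  exact: (job_phase_type p01 type_law X1_law X2_law indep).
have mean1 : (alpha *m (invmx (- S) *m (const_mx 1 : 'cV[R]_(n1 + n2)))) 0 0 = 1.
  (* The normalization is given as an expectation; here it becomes alpha (-S)^-1 1 = 1. *)
  apply: EFin_inj; rewrite -(phase_type_mean S_subgen S_unit alpha_prob (J_ge0 0%N) J_law).
  exact: (mean_size 0%N).
have Z_tail t : 0 <= t -> ccdf Z t =
    (lambda * total_mass (alpha *m expmx (t *: T) *m invmx (- S)))%:E.
  move=> t0; rewrite /total_mass -mulmxA.
  apply: (stationary_workload_tail (tau := tau) (J := J)) => //.
    exact: (interarrival_workload_job_indep p01 type_law indep).
  exact: (interarrival_times_indep indep).
split=> [t t0|]; first by split; [exact: Z_tail|exact: workload_tail_two_forms].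
have [thZ0 [eta e0 eS]] :=
  workload_decay_exponent S_subgen S_unit alpha_prob lambda01 mean1 (lexx _).
have [p0 p1] := andP p01; have [l0 _] := andP lambda01.
have [eS1 eS2] := mixture_resolvent eS.
exists (decay_exponent S1 (mxsum S1) alpha1), (decay_exponent S2 (mxsum S2) alpha2),
  (decay_exponent T (mxsum S) alpha); split.
- by move=> k; exact: phase_type_decay_rate.
- by move=> k; exact: phase_type_decay_rate.
- have T0 := rank_one_update_shift_ge0 S_subgen alpha_prob lambda01 (lexx _).
  have [a0 _] := alpha_prob; have an0 := probability_vector_neq0 alpha_prob.
  (* Absorbing lambda and (-S)^-1 1 into one positive column gives the tail of [Z] the form alpha
     e^{tT} v required by the general decay results. *)
  pose v := lambda *: (invmx (- S) *m (const_mx 1 : 'cV[R]_(n1 + n2))).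
  have v0 i : 0 < v i 0.
    by rewrite /v mxE mulr_gt0 //; exact: subgenerator_inv_gt0.
  have vE t : lambda * total_mass (alpha *m expmx (t *: T) *m invmx (- S)) =
      (alpha *m expmx (t *: T) *m v) 0 0.
    by rewrite /total_mass -mulmxA /v -(scalemxAr lambda) [RHS]mxE.
  apply: (@has_decay_rateP _ _ _ _ _ (fun t => (alpha *m expmx (t *: T) *m v) 0 0)).
  + by move=> t t0; rewrite Z_tail // vE.
  + by move=> t t0; exact: (phase_tail_gt0 T0 a0 an0 v0).
  + exact: (decay_exponent_cvg T0 a0 an0 v0).
have e1 i : 0 <= lsubmx eta 0 i by rewrite mxE.
have e2 i : 0 <= rsubmx eta 0 i by rewrite mxE.
have q0 : 0 < 1 - p by rewrite subr_gt0.
(* The two blocks of [eta] solve the resolvent equations of [S1] and [S2] at the level -theta_Z,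
   which places theta_Z strictly below each rate. *)
have lt1 := decay_exponent_gt_source p0 S1_subgen alpha1_prob e1 eS1.
have lt2 := decay_exponent_gt_source q0 S2_subgen alpha2_prob e2 eS2.
by rewrite thZ0 lt_min lt1 lt2.
Qed.
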